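(* Consider the power system described by the Lur'e model $\dot x=Ax-B\phi(Cx)+H\eta$. Let $|\theta_{ij}|\le\overline\theta_{ij}$ for all $(i,j)\in\mathcal{E}$ and $|\omega_i|\le\overline\omega_i$ for all $i\in\mathcal{N}$ be operational constraints on the angle differences and on the frequencies, and let $\eta$ be a time-varying disturbance entering the post-fault dynamics. Let $P=P^T\in\mathbb{R}^{2n\times 2n}$ be positive definite, $\lambda_k\ge 0$ for $k\in\{1,\dots,|\mathcal{E}|\}$, $\Gamma\in\mathbb{R}^{|\mathcal{E}|\times|\mathcal{E}|}$ a positive definite diagonal matrix, and let $V$, $R$, $V_{\max}$, $\hat V_{\max}$ be built from these data as in the context. Put $\mathcal{X}=\{x\in\mathbb{R}^{2n}:V(x)\le V_{\max}\}\cap\mathcal{P}$ and $$\overline\eta=\frac{\sigma_{\min}(-R)}{2\|PH\|\sqrt{\sigma_{\max}(P)+\mu\|C\|^2}}\sqrt{\hat V_{\max}},\qquad \mu=\max_{k\in\{1,\dots,|\mathcal{E}|\}}\lambda_k(\overline\delta_k-\underline\delta_k).$$ If $R\prec0$, the fault-cleared state (the initial state of the post-fault trajectory) lies in $\mathcal{X}$, and $\|\eta\|_{\mathcal{L}_\infty}<\overline\eta$, then the post-fault trajectory never escapes the set $\mathcal{X}$, i.e. it never violates the operational constraints. Moreover, the post-fault trajectory converges to the set $\{x:V(x)<\hat V_{\max}\}$. In particular, if $\eta=0$, the post-fault trajectory converges to the post-fault equilibrium point $x=0$.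
   Context: Power system model. $\mathcal{N}=\{1,\dots,n\}$ is a set of generators and $\mathcal{E}$ a set of (arbitrarily oriented) transmission lines; in addition there is an infinite bus, used as angle reference: a node whose angle and frequency are identically $0$, to which lines of $\mathcal{E}$ may be attached, and which is not part of the state. The graph formed by all nodes and lines is connected. $E\in\mathbb{R}^{n\times|\mathcal{E}|}$ is the incidence matrix with the row of the infinite bus removed, so that $E^T\theta$ is the vector of angle differences $\theta_{ij}=\theta_i-\theta_j$, $(i,j)\in\mathcal{E}$. $k\sim(i,j)$ means that $k\in\{1,\dots,|\mathcal{E}|\}$ is the index of edge $(i,j)$. $M=\mathrm{diag}(m_i)$, $D=\mathrm{diag}(d_i)$, $Y=\mathrm{diag}(y_{ij})_{(i,j)\in\mathcal{E}}$ have positive diagonal entries; $p\in\mathbb{R}^n$ is the vector of mechanical torques; $\sin,\cos$ of vectors act componentwise. $\theta^*$ satisfies $p=EY\sin(E^T\theta^* )$ and $\|E^T\theta^*\|_\infty<\pi/2$; $\theta^*_{ij}=\theta^*_i-\theta^*_j$. The disturbed post-fault dynamics are $\dot\theta=\omega$, $M\dot\omega+D\omega=p-EY\sin(E^T\theta)+\eta$, with $\eta:[0,\infty)\to\mathbb{R}^n$. With state $x=[(\theta-\theta^* )^T,\omega^T]^T\in\mathbb{R}^{2n}$ (post-fault equilibrium $x=0$) they read $\dot x=Ax-B\phi(z)+H\eta$, $z=Cx$, with $$A=\begin{bmatrix}0&I\\ -M^{-1}EY\,\mathrm{diag}(\cos(E^T\theta^* ))E^T&-M^{-1}D\end{bmatrix},\quad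 B=\begin{bmatrix}0\\ M^{-1}EY\end{bmatrix},\quad C=\begin{bmatrix}E^T&0\end{bmatrix},\quad H=\begin{bmatrix}0\\ M^{-1}\end{bmatrix},$$ and $\phi(z)=[\phi_1(z_1),\dots,\phi_{|\mathcal{E}|}(z_{|\mathcal{E}|})]^T$, where for $k\sim(i,j)$, $z_k=\theta_{ij}-\theta^*_{ij}$ and $\phi_k(z_k)=(\sin\theta_{ij}-\sin\theta^*_{ij})-\cos\theta^*_{ij}(\theta_{ij}-\theta^*_{ij})$. Operational constraints. $\mathcal{P}_1=\{x:\theta_{ij}\in[-\pi-\theta^*_{ij},\pi-\theta^*_{ij}]\ \forall(i,j)\in\mathcal{E}\}$, $\mathcal{P}_2=\{x:\theta_{ij},\theta_{ij}^*\in[-\pi/2,\pi/2]\ \forall(i,j)\in\mathcal{E}\}$. $\mathcal{P}=\{x:|\theta_{ij}|\le\overline{\theta}_{ij}\ \forall(i,j)\in\mathcal{E}\}$ with bounds $\overline\theta_{ij}$ such that $\mathcal{P}_2\subseteq\mathcal{P}\subseteq\mathcal{P}_1$, and $\mathcal{S}=\{x:|\omega_i|\le\overline\omega_i\ \forall i\in\mathcal{N}\}$ with $\overline\omega_i>0$. Sector bounds. For $k\sim(i,j)$, $\overline\delta_k=1-\cos\theta^*_{ij}$, and $\underline\delta_k$ is a fixed number such that $\phi_k(z_k)/z_k\in[\underline\delta_k,\overline\delta_k]$ for all $x\in\mathcal{P}$ with $z_k\neq0$; namely $\underline\delta_k=-\cos\theta_{ij}^*$ when $\mathcal{P}=\mathcal{P}_1$,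 $\underline\delta_k=\xi_k-\cos\theta^*_{ij}$ with $\xi_k=\frac{1-\sin|\theta^*_{ij}|}{\pi/2-|\theta^*_{ij}|}$ when $\mathcal{P}=\mathcal{P}_2$, and for intermediate $\mathcal{P}$, $\underline\delta_k=\varphi_k-\cos\theta_{ij}^*$ with some $\varphi_k\in(0,\xi_k)$ for which the bound holds on $\mathcal{P}$. Lyapunov function and matrices. $$V(x)=x^TPx+2\sum_{k=1}^{|\mathcal{E}|}\lambda_k\int_0^{z_k(x)}(\overline\delta_k s-\phi_k(s))\,ds.$$ $\Lambda=\mathrm{diag}(\lambda_k)$, $\underline\Delta=\mathrm{diag}(\underline\delta_k)$, $\overline\Delta=\mathrm{diag}(\overline\delta_k)$, and $R=\begin{bmatrix}R_{11}&R_{12}\\R_{12}^T&R_{22}\end{bmatrix}$ with $R_{11}=A^T(P+C^T\Lambda\overline\Delta C)+(P+C^T\overline\Delta\Lambda C)A-2C^T\underline\Delta\Gamma\overline\Delta C$, $R_{12}=-PB-A^TC^T\Lambda+C^T(\underline\Delta+\overline\Delta)\Gamma$, $R_{22}=-2\Gamma$. Optimization problems. $\mathcal{P}_{ij}^{\pm}=\{x\in\mathcal{P}:\theta_{ij}=\pm\overline\theta_{ij}\}$ and $\mathcal{S}_i^{\pm}=\{x\in\mathcal{S}:\omega_i=\pm\overline\omega_i\}$. $V_{ij}^-=\min\{V(x):x\in\mathcal{P}_{ij}^-,\ \omega_i\le\omega_j\}$, $V_{ij}^+=\min\{V(x):x\in\mathcal{P}_{ij}^+,\ \omega_i\ge\omega_j\}$,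 $\hat V_{ij}^{\pm}=\min\{V(x):x\in\mathcal{P}_{ij}^{\pm}\}$ for $(i,j)\in\mathcal{E}$, and $W_i^{\pm}=\min\{V(x):x\in\mathcal{S}_i^{\pm}\}$ for $i\in\mathcal{N}$ (the minimum over an empty set is $+\infty$). $V^*=\min\{V_{ij}^-,V_{ij}^+\}_{(i,j)\in\mathcal{E}}$, $\hat V^*=\min\{\hat V_{ij}^-,\hat V_{ij}^+\}_{(i,j)\in\mathcal{E}}$, $W^*=\min\{W_i^-,W_i^+\}_{i\in\mathcal{N}}$, $V_{\max}=\min\{V^*,W^*\}$, $\hat V_{\max}=\min\{\hat V^*,W^*\}$. Notation. $\sigma_{\min},\sigma_{\max}$ are the minimum and maximum eigenvalues; $\prec$ is the definite matrix order; $\|\cdot\|$ is the Euclidean norm (induced norm for matrices); $\|\eta\|_{\mathcal{L}_\infty}=\operatorname{ess\,sup}_{t\ge0}\|\eta(t)\|$. *)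

(* Defs.v *)
From HB Require Import structures.
From mathcomp Require Import all_boot all_order all_algebra.
From mathcomp Require Import all_classical all_reals all_analysis.
From mathcomp Require Import ess_sup_inf.

Set Implicit Arguments.
Unset Strict Implicit.
Unset Printing Implicit Defensive.

Import Order.TTheory GRing.Theory Num.Theory.
Import numFieldNormedType.Exports.

Local Open Scope classical_set_scope.
Local Open Scope ring_scope.

(* The norm that the library puts on 'M[R]_(m, n) is the entrywise maximum
   norm, hence the separate Euclidean norm. *)
Definition enorm (R : realType) (n : nat) (v : 'cV[R]_n) : R :=
  Num.sqrt (\sum_(i < n) v i ord0 ^+ 2).

Definition opnorm (R : realType) (m n : nat) (A : 'M[R]_(m, n)) : R :=
  sup [set enorm (A *m v) | v in [set v : 'cV[R]_n | enorm v <= 1]].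

(* Only used for real symmetric matrices of positive size, whose spectrum is a
   nonempty finite set of reals. *)
Definition eig_min (R : realType) (n : nat) (A : 'M[R]_n) : R :=
  inf [set a : R | eigenvalue A a].
Definition eig_max (R : realType) (n : nat) (A : 'M[R]_n) : R :=
  sup [set a : R | eigenvalue A a].

Definition posdefmx (R : realType) (n : nat) (A : 'M[R]_n) : Prop :=
  A^T = A /\ forall v : 'cV[R]_n, v != 0 -> 0 < (v^T *m A *m v) ord0 ord0.
Definition negdefmx (R : realType) (n : nat) (A : 'M[R]_n) : Prop :=
  posdefmx (- A).

(* The integral from a to b with the usual sign convention when b < a. *)
Definition oriented_integral (R : realType) (a b : R) (f : R -> R) : R :=
  if a <= b then Rintegral lebesgue_measure `[a, b] f
  else - Rintegral lebesgue_measure `[b, a] f.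

Definition Linfty_norm (R : realType) (n : nat) (u : R -> 'cV[R]_n) : \bar R :=
  ess_sup (mrestr (@lebesgue_measure R) (measurable_itv `[0, +oo[))
    (fun t : R => (enorm (u t))%:E).

Definition converges_to_set (R : realType) (n : nat)
    (x : R -> 'cV[R]_n) (S : set 'cV[R]_n) : Prop :=
  forall e : R, 0 < e ->
    \forall t \near +oo, exists2 y, S y & enorm (x t - y) < e.

(* Nodes: [Some i] is generator i, [None] is the infinite bus. *)
Definition node (n : nat) : finType := option 'I_n.

(* [line k] = (i, j) stands for k ~ (i, j). *)
Record power_system (R : realType) (n m : nat) := PowerSystem {
  line : 'I_m -> node n * node n;
  inertia : 'I_n -> R;
  damping : 'I_n -> R;
  coupling : 'I_m -> R;
  torque : 'cV[R]_n;
  theq : 'cV[R]_n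
}.

(* Distinct indices are distinct lines, whatever their orientations; a line
   joins two different nodes. *)
Definition simple_lines (R : realType) (n m : nat)
    (G : power_system R n m) : Prop :=
  [/\ forall k, (line G k).1 != (line G k).2,
      injective (line G) &
      forall k l, line G k != ((line G l).2, (line G l).1)].

Definition adjacent (R : realType) (n m : nat) (G : power_system R n m) :
    rel (node n) :=
  fun u v => [exists k, (line G k == (u, v)) || (line G k == (v, u))].

Definition connected_graph (R : realType) (n m : nat)
    (G : power_system R n m) : Prop :=
  forall u v : node n, connect (adjacent G) u v.

(* Angle or frequency of a node; both vanish at the infinite bus. *)
Definition at_node (R : realType) (n : nat) (v : 'cV[R]_n) (u : node n) : R :=
  if u is Some i then v i ord0 else 0.

Definition line_diff (R : realType) (n m : nat) (G : power_system R n m)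
    (v : 'cV[R]_n) (k : 'I_m) : R :=
  at_node v (line G k).1 - at_node v (line G k).2.

Definition incidence (R : realType) (n m : nat) (G : power_system R n m) :
    'M[R]_(n, m) :=
  \matrix_(i, k) (((line G k).1 == Some i)%:R - ((line G k).2 == Some i)%:R).

Definition inertia_mx (R : realType) (n m : nat) (G : power_system R n m) :
    'M[R]_n := diag_mx (\row_i inertia G i).
Definition damping_mx (R : realType) (n m : nat) (G : power_system R n m) :
    'M[R]_n := diag_mx (\row_i damping G i).
Definition coupling_mx (R : realType) (n m : nat) (G : power_system R n m) :
    'M[R]_m := diag_mx (\row_k coupling G k).

Definition is_equilibrium (R : realType) (n m : nat)
    (G : power_system R n m) : Prop :=
  torque G = incidence G *m coupling_mx G
               *m map_mx sin ((incidence G)^T *m theq G)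
  /\ mx_norm ((incidence G)^T *m theq G) < pi / 2.

Definition Amx (R : realType) (n m : nat) (G : power_system R n m) :
    'M[R]_(n + n) :=
  block_mx 0 1%:M
    (- (invmx (inertia_mx G) *m incidence G *m coupling_mx G
          *m diag_mx (\row_k cos (line_diff G (theq G) k)) *m (incidence G)^T))
    (- (invmx (inertia_mx G) *m damping_mx G)).
Definition Bmx (R : realType) (n m : nat) (G : power_system R n m) :
    'M[R]_(n + n, m) :=
  col_mx 0 (invmx (inertia_mx G) *m incidence G *m coupling_mx G).
Definition Cmx (R : realType) (n m : nat) (G : power_system R n m) :
    'M[R]_(m, n + n) := row_mx (incidence G)^T 0.
Definition Hmx (R : realType) (n m : nat) (G : power_system R n m) :
    'M[R]_(n + n, n) := col_mx 0 (invmx (inertia_mx G)).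

(* theta_ij = theta*_ij + s, where s = z_k. *)
Definition phi (R : realType) (n m : nat) (G : power_system R n m)
    (k : 'I_m) (s : R) : R :=
  let thk := line_diff G (theq G) k in
  (sin (thk + s) - sin thk) - cos thk * s.

Definition phi_vec (R : realType) (n m : nat) (G : power_system R n m)
    (z : 'cV[R]_m) : 'cV[R]_m := \col_k phi G k (z k ord0).

Definition lure_field (R : realType) (n m : nat) (G : power_system R n m)
    (x : 'cV[R]_(n + n)) (u : 'cV[R]_n) : 'cV[R]_(n + n) :=
  Amx G *m x - Bmx G *m phi_vec G (Cmx G *m x) + Hmx G *m u.

(* Caratheodory solution on [0, +oo[ of x' = A x - B phi(C x) + H eta: since
   eta is only essentially bounded, the equation is integrated in time. *)
Definition is_trajectory (R : realType) (n m : nat) (G : power_system R n m)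
    (eta : R -> 'cV[R]_n) (x : R -> 'cV[R]_(n + n)) : Prop :=
  forall t : R, 0 <= t -> forall i : 'I_(n + n),
    let f := fun s : R => lure_field G (x s) (eta s) i ord0 in
    integrable lebesgue_measure `[0, t] (EFin \o f) /\
    x t i ord0 = x 0 i ord0 + Rintegral lebesgue_measure `[0, t] f.

(* The state is x = (theta - theta*, omega). *)
Definition angles (R : realType) (n m : nat) (G : power_system R n m)
    (x : 'cV[R]_(n + n)) : 'cV[R]_n := theq G + usubmx x.
Definition freqs (R : realType) (n : nat) (x : 'cV[R]_(n + n)) : 'cV[R]_n :=
  dsubmx x.

Definition P1set (R : realType) (n m : nat) (G : power_system R n m) :
    set 'cV[R]_(n + n) :=
  [set x | forall k, - pi - line_diff G (theq G) k <= line_diff G (angles G x) k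
                     <= pi - line_diff G (theq G) k].
Definition P2set (R : realType) (n m : nat) (G : power_system R n m) :
    set 'cV[R]_(n + n) :=
  [set x | forall k, - (pi / 2) <= line_diff G (angles G x) k <= pi / 2
                  /\ - (pi / 2) <= line_diff G (theq G) k <= pi / 2].
Definition Pset (R : realType) (n m : nat) (G : power_system R n m)
    (thbar : 'I_m -> R) : set 'cV[R]_(n + n) :=
  [set x | forall k, `|line_diff G (angles G x) k| <= thbar k].
Definition Sset (R : realType) (n : nat) (ombar : 'I_n -> R) :
    set 'cV[R]_(n + n) :=
  [set x | forall i, `|freqs x i ord0| <= ombar i].

Definition dhigh (R : realType) (n m : nat) (G : power_system R n m)
    (k : 'I_m) : R := 1 - cos (line_diff G (theq G) k).

Definition xi (R : realType) (n m : nat) (G : power_system R n m)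
    (k : 'I_m) : R :=
  (1 - sin `|line_diff G (theq G) k|) / (pi / 2 - `|line_diff G (theq G) k|).

Definition sector_bound (R : realType) (n m : nat) (G : power_system R n m)
    (thbar dlow : 'I_m -> R) : Prop :=
  forall x, Pset G thbar x -> forall k, let z := (Cmx G *m x) k ord0 in
    z != 0 -> dlow k <= phi G k z / z <= dhigh G k.

Definition lower_sector_value (R : realType) (n m : nat)
    (G : power_system R n m) (thbar dlow : 'I_m -> R) : Prop :=
  [/\ Pset G thbar = P1set G ->
        forall k, dlow k = - cos (line_diff G (theq G) k),
      Pset G thbar = P2set G ->
        forall k, dlow k = xi G k - cos (line_diff G (theq G) k) &
      Pset G thbar <> P1set G -> Pset G thbar <> P2set G ->
        forall k, exists varphi : R, 0 < varphi < xi G k /\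
          dlow k = varphi - cos (line_diff G (theq G) k)].

Definition Lyap (R : realType) (n m : nat) (G : power_system R n m)
    (P : 'M[R]_(n + n)) (lam : 'I_m -> R) (x : 'cV[R]_(n + n)) : R :=
  (x^T *m P *m x) ord0 ord0
  + 2 * \sum_(k < m) lam k *
          oriented_integral 0 ((Cmx G *m x) k ord0)
            (fun s => dhigh G k * s - phi G k s).

Definition Rmx (R : realType) (n m : nat) (G : power_system R n m)
    (dlow : 'I_m -> R) (P : 'M[R]_(n + n)) (lam : 'I_m -> R)
    (Gam : 'M[R]_m) : 'M[R]_((n + n) + m) :=
  let A := Amx G in let B := Bmx G in let C := Cmx G in
  let Lam := diag_mx (\row_k lam k) in
  let Dl := diag_mx (\row_k dlow k) in
  let Dh := diag_mx (\row_k dhigh G k) in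
  let R11 := A^T *m (P + C^T *m Lam *m Dh *m C)
             + (P + C^T *m Dh *m Lam *m C) *m A
             - 2 *: (C^T *m Dl *m Gam *m Dh *m C) in
  let R12 := - (P *m B) - A^T *m C^T *m Lam + C^T *m (Dl + Dh) *m Gam in
  let R22 := - (2 *: Gam) in
  block_mx R11 R12 R12^T R22.

(* ereal_inf is +oo on the empty set; all other minima below are attained, the
   function V being continuous and coercive and the sets closed. *)
Definition min_over (R : realType) (T : Type) (V : T -> R) (S : set T) :
    \bar R := ereal_inf [set (V x)%:E | x in S].

Definition Pminus (R : realType) (n m : nat) (G : power_system R n m)
    (thbar : 'I_m -> R) (k : 'I_m) : set 'cV[R]_(n + n) :=
  [set x | Pset G thbar x /\ line_diff G (angles G x) k = - thbar k].
Definition Pplus (R : realType) (n m : nat) (G : power_system R n m)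
    (thbar : 'I_m -> R) (k : 'I_m) : set 'cV[R]_(n + n) :=
  [set x | Pset G thbar x /\ line_diff G (angles G x) k = thbar k].
Definition Sminus (R : realType) (n : nat) (ombar : 'I_n -> R) (i : 'I_n) :
    set 'cV[R]_(n + n) :=
  [set x | Sset ombar x /\ freqs x i ord0 = - ombar i].
Definition Splus (R : realType) (n : nat) (ombar : 'I_n -> R) (i : 'I_n) :
    set 'cV[R]_(n + n) :=
  [set x | Sset ombar x /\ freqs x i ord0 = ombar i].

Definition Vminus (R : realType) (n m : nat) (G : power_system R n m)
    (thbar : 'I_m -> R) (V : 'cV[R]_(n + n) -> R) (k : 'I_m) : \bar R :=
  min_over V [set x | Pminus G thbar k x /\
    at_node (freqs x) (line G k).1 <= at_node (freqs x) (line G k).2].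
Definition Vplus (R : realType) (n m : nat) (G : power_system R n m)
    (thbar : 'I_m -> R) (V : 'cV[R]_(n + n) -> R) (k : 'I_m) : \bar R :=
  min_over V [set x | Pplus G thbar k x /\
    at_node (freqs x) (line G k).1 >= at_node (freqs x) (line G k).2].

Definition Vstar (R : realType) (n m : nat) (G : power_system R n m)
    (thbar : 'I_m -> R) (V : 'cV[R]_(n + n) -> R) : \bar R :=
  \big[mine/+oo%E]_(k < m) mine (Vminus G thbar V k) (Vplus G thbar V k).
Definition Vhatstar (R : realType) (n m : nat) (G : power_system R n m)
    (thbar : 'I_m -> R) (V : 'cV[R]_(n + n) -> R) : \bar R :=
  \big[mine/+oo%E]_(k < m)
    mine (min_over V (Pminus G thbar k)) (min_over V (Pplus G thbar k)).
Definition Wstar (R : realType) (n : nat) (ombar : 'I_n -> R)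
    (V : 'cV[R]_(n + n) -> R) : \bar R :=
  \big[mine/+oo%E]_(i < n)
    mine (min_over V (Sminus ombar i)) (min_over V (Splus ombar i)).

Definition Vmax (R : realType) (n m : nat) (G : power_system R n m)
    (thbar : 'I_m -> R) (ombar : 'I_n -> R) (V : 'cV[R]_(n + n) -> R) :
    \bar R := mine (Vstar G thbar V) (Wstar ombar V).
Definition Vhatmax (R : realType) (n m : nat) (G : power_system R n m)
    (thbar : 'I_m -> R) (ombar : 'I_n -> R) (V : 'cV[R]_(n + n) -> R) :
    \bar R := mine (Vhatstar G thbar V) (Wstar ombar V).

Definition Xset (R : realType) (n m : nat) (G : power_system R n m)
    (thbar : 'I_m -> R) (ombar : 'I_n -> R) (V : 'cV[R]_(n + n) -> R) :
    set 'cV[R]_(n + n) :=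
  [set x | ((V x)%:E <= Vmax G thbar ombar V)%E] `&` Pset G thbar.

(* The supremum is over a finite set, nonempty as soon as there is a line. *)
Definition mu_const (R : realType) (n m : nat) (G : power_system R n m)
    (dlow lam : 'I_m -> R) : R :=
  sup (range (fun k : 'I_m => lam k * (dhigh G k - dlow k))).

(* For n > 0 the value Vhatmax is finite, because the sets S_i^+- are
   nonempty, so that fine only changes its type. *)
Definition etabar (R : realType) (n m : nat) (G : power_system R n m)
    (thbar : 'I_m -> R) (ombar : 'I_n -> R) (dlow : 'I_m -> R)
    (P : 'M[R]_(n + n)) (lam : 'I_m -> R) (Gam : 'M[R]_m) : R :=
  eig_min (- Rmx G dlow P lam Gam)
  / (2 * opnorm (P *m Hmx G)
     * Num.sqrt (eig_max P + mu_const G dlow lam * opnorm (Cmx G) ^+ 2))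
  * Num.sqrt (fine (Vhatmax G thbar ombar (Lyap G P lam))).

(* Main.v *)
Require Import Defs.
From HB Require Import structures.
From mathcomp Require Import all_boot all_order all_algebra.
From mathcomp Require Import all_classical all_reals all_analysis.
From mathcomp Require Import ess_sup_inf.
From mathcomp Require Import ring lra.

Set Implicit Arguments.
Unset Strict Implicit.
Unset Printing Implicit Defensive.

Import Order.TTheory GRing.Theory Num.Theory.
Import numFieldNormedType.Exports.

Local Open Scope classical_set_scope.
Local Open Scope ring_scope.

(** Along the trajectory the state is only absolutely continuous, so the
    dissipation inequality is used as a bound on the right Dini derivative of
    [V]: expand [V] to second order at the current state, bound the increment
    of the state by integrating the field, and use the S-procedure for
    [R < 0].  Where [V >= Vhatmax] inside the polytope [P], this derivative is
    negative and bounded away from [0], because [V <= K |x|^2] there.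

    To see that the trajectory cannot leave [P], suppose it did just after a
    time [s].  Then [V < Vmax] right after [s].  Take a time [t] at which the
    gauge of [P] is maximal, and shrink [x t] to the boundary of [P]: [V]
    decreases, so the shrunk state lies on a face below the level [Vmax],
    where by definition of [Vmax] the flow through that face is strictly
    inwards.  As the frequencies are only rescaled, the gauge was larger just
    before [t], a contradiction. *)

(** * Euclidean norm, operator norm and Rayleigh quotients *)

Section EuclideanGeometry.
Context {R : realType}.

Definition dotv n (u v : 'cV[R]_n) : R := (u^T *m v) ord0 ord0.

Lemma dotvE n (u v : 'cV[R]_n) : dotv u v = \sum_i u i ord0 * v i ord0.
Proof. by rewrite /dotv mxE; apply: eq_bigr => i _; rewrite mxE. Qed.

Lemma dotvC n (u v : 'cV[R]_n) : dotv u v = dotv v u.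
Proof. by rewrite !dotvE; apply: eq_bigr => i _; rewrite mulrC. Qed.

Lemma dotvDr n (u v w : 'cV[R]_n) : dotv u (v + w) = dotv u v + dotv u w.
Proof. by rewrite /dotv mulmxDr mxE. Qed.

Lemma dotvDl n (u v w : 'cV[R]_n) : dotv (u + v) w = dotv u w + dotv v w.
Proof. by rewrite dotvC dotvDr !(dotvC w). Qed.

Lemma dotvZr n a (u v : 'cV[R]_n) : dotv u (a *: v) = a * dotv u v.
Proof. by rewrite /dotv -scalemxAr mxE. Qed.

Lemma dotvZl n a (u v : 'cV[R]_n) : dotv (a *: u) v = a * dotv u v.
Proof. by rewrite dotvC dotvZr dotvC. Qed.

Lemma dotvNr n (u v : 'cV[R]_n) : dotv u (- v) = - dotv u v.
Proof. by rewrite -scaleN1r dotvZr mulN1r. Qed.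

Lemma dotvNl n (u v : 'cV[R]_n) : dotv (- u) v = - dotv u v.
Proof. by rewrite dotvC dotvNr dotvC. Qed.

Lemma dotv0r n (u : 'cV[R]_n) : dotv u 0 = 0.
Proof. by rewrite -(scale0r 0) dotvZr mul0r. Qed.

Definition dotv_linear := (dotvDl, dotvDr, dotvNl, dotvNr, dotvZl, dotvZr).

Lemma dotv_trmx m n (A : 'M[R]_(m, n)) u v :
  dotv u (A *m v) = dotv (A^T *m u) v.
Proof. by rewrite /dotv trmx_mul trmxK mulmxA. Qed.

Lemma dotv_col m n (u1 v1 : 'cV[R]_m) (u2 v2 : 'cV[R]_n) :
  dotv (col_mx u1 u2) (col_mx v1 v2) = dotv u1 v1 + dotv u2 v2.
Proof. by rewrite /dotv tr_col_mx mul_row_col mxE. Qed.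

Lemma dotvv_ge0 n (u : 'cV[R]_n) : 0 <= dotv u u.
Proof. by rewrite dotvE; apply: sumr_ge0 => i _; rewrite -expr2 sqr_ge0. Qed.

Lemma dotvv_eq0 n (u : 'cV[R]_n) : dotv u u = 0 -> u = 0.
Proof.
rewrite dotvE => /psumr_eq0P u0; apply/matrixP => i j.
rewrite ord1 mxE; apply/eqP; rewrite -sqrf_eq0 expr2; apply/eqP/u0 => // k _.
by rewrite -expr2 sqr_ge0.
Qed.

Lemma enorm_sqr n (u : 'cV[R]_n) : enorm u ^+ 2 = dotv u u.
Proof.
rewrite /enorm sqr_sqrtr; last by apply: sumr_ge0 => i _; rewrite sqr_ge0.
by rewrite dotvE; apply: eq_bigr => i _; rewrite expr2.
Qed.

Lemma enorm_ge0 n (u : 'cV[R]_n) : 0 <= enorm u.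
Proof. exact: sqrtr_ge0. Qed.

Lemma enorm_eq0 n (u : 'cV[R]_n) : enorm u = 0 -> u = 0.
Proof. by move=> u0; apply: dotvv_eq0; rewrite -enorm_sqr u0 expr0n. Qed.

Lemma enorm0 n : enorm (0 : 'cV[R]_n) = 0.
Proof.
by apply/eqP; rewrite -sqrf_eq0 enorm_sqr dotv0r.
Qed.

Lemma enorm_gt0 n (u : 'cV[R]_n) : (0 < enorm u) = (u != 0).
Proof.
rewrite lt_def enorm_ge0 andbT; congr (~~ _).
by apply/eqP/eqP => [/enorm_eq0|->]; rewrite ?enorm0.
Qed.

Lemma enormZ n a (u : 'cV[R]_n) : enorm (a *: u) = `|a| * enorm u.
Proof.
apply/(@pexpIrn _ 2) => //; rewrite ?nnegrE ?mulr_ge0 ?enorm_ge0//.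
by rewrite exprMn !enorm_sqr !dotv_linear real_normK ?num_real//; ring.
Qed.

Lemma coord_le_enorm n (u : 'cV[R]_n) i : `|u i ord0| <= enorm u.
Proof.
rewrite -(@ler_pXn2r _ 2)// ?nnegrE ?enorm_ge0// enorm_sqr dotvE.
rewrite (bigD1 i)//= real_normK ?num_real// expr2 lerDl.
by apply: sumr_ge0 => k _; rewrite -expr2 sqr_ge0.
Qed.

Lemma psd_cauchy_schwarz n (B : 'M[R]_n) u v : B^T = B ->
  (forall w, 0 <= dotv w (B *m w)) ->
  dotv u (B *m v) ^+ 2 <= dotv u (B *m u) * dotv v (B *m v).
Proof.
move=> symB B0.
have vBu : dotv v (B *m u) = dotv u (B *m v) by rewrite dotv_trmx symB dotvC.
have H s t : 0 <= s ^+ 2 * dotv u (B *m u) + s * t * dotv u (B *m v) *+ 2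
                  + t ^+ 2 * dotv v (B *m v).
  have := B0 (s *: u + t *: v).
  rewrite mulmxDr -!scalemxAr !dotv_linear vBu.
  by congr (_ <= _); ring.
move: (B0 u) (B0 v) vBu H.
set a := dotv v (B *m v); set b := dotv u (B *m v); set c := dotv u (B *m u).
(* The form is evaluated at three combinations of [u] and [v]: two of them give the claim multiplied
   by [a] and by [c], and the third forces [b = 0] when [a] and [c] both vanish. *)
move=> c0 a0 _ H; have := H a (- b); have := H b (- c); have := H 1 (- b).
have [|a1|/= a1] := ltgtP a 0; first by rewrite ltNge a0.
  by move=> _ _; nra.
have [|c1|/= c1] := ltgtP c 0; first by rewrite ltNge c0.
  by move=> _ h _; nra.
by rewrite c1 a1; nra.
Qed.

Lemma dotv_le_enorm n (u v : 'cV[R]_n) : dotv u v <= enorm u * enorm v.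
Proof.
have H : dotv u v ^+ 2 <= (enorm u * enorm v) ^+ 2.
  have := @psd_cauchy_schwarz n 1%:M u v (trmx1 _ _).
  rewrite !mul1mx exprMn !enorm_sqr; apply => w.
  by rewrite mul1mx dotvv_ge0.
apply: le_trans (ler_norm _) _.
by rewrite -(@ler_pXn2r _ 2)// ?nnegrE ?mulr_ge0 ?enorm_ge0// real_normK ?num_real.
Qed.

Lemma opnorm_has_sup m n (A : 'M[R]_(m, n)) :
  has_sup [set enorm (A *m v) | v in [set v : 'cV[R]_n | enorm v <= 1]].
Proof.
split; first by exists (enorm (A *m 0)), 0 => //=; rewrite enorm0.
(* By Cauchy-Schwarz on each row, the squared Frobenius norm [S] bounds [enorm (A *m v) ^+ 2];
   adding 1 avoids a square root, as [y ^+ 2 <= S] implies [y <= 1 + S]. *)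
exists (1 + \sum_i enorm (row i A)^T ^+ 2) => _ [v /= v1 <-].
have s0 : 0 <= \sum_i enorm (row i A)^T ^+ 2.
  by apply: sumr_ge0 => i _; rewrite sqr_ge0.
have : enorm (A *m v) ^+ 2 <= \sum_i enorm (row i A)^T ^+ 2.
  rewrite enorm_sqr dotvE; apply: ler_sum => i _.
  have -> : (A *m v) i ord0 = dotv (row i A)^T v.
    by rewrite dotvE !mxE; apply: eq_bigr => j _; rewrite !mxE.
  have := @psd_cauchy_schwarz n 1%:M (row i A)^T v (trmx1 _ _).
  rewrite !mul1mx -expr2 -!enorm_sqr => /(_ _)/le_trans -> //.
    by move=> w; rewrite mul1mx dotvv_ge0.
  rewrite ler_piMr ?sqr_ge0// expr_le1//; exact: enorm_ge0.
by have := enorm_ge0 (A *m v); nra.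
Qed.

Lemma opnorm_ge0 m n (A : 'M[R]_(m, n)) : 0 <= opnorm A.
Proof.
apply: le_trans (enorm_ge0 (A *m 0)) _.
by apply: ub_le_sup; [case: (opnorm_has_sup A)|exists 0 => //=; rewrite enorm0].
Qed.

Lemma enorm_mulmx_le m n (A : 'M[R]_(m, n)) v :
  enorm (A *m v) <= opnorm A * enorm v.
Proof.
have [v0|] := eqVneq (enorm v) 0.
  by rewrite (enorm_eq0 v0) mulmx0 !enorm0 mulr0.
move=> v0; have {v0} : 0 < enorm v by rewrite lt_def v0 enorm_ge0.
move=> v0; rewrite -ler_pdivrMr// mulrC -[X in X * _]gtr0_norm ?invr_gt0//.
rewrite -enormZ scalemxAr; apply: ub_le_sup; first by case: (opnorm_has_sup A).
by exists ((enorm v)^-1 *: v) => //=; rewrite enormZ gtr0_norm ?invr_gt0// mulVf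
  ?gt_eqF.
Qed.

(** Cauchy-Schwarz for the form [B] at the pair [B *m v], [v] bounds [enorm (B *m v) ^+ 2] by
    [opnorm B] times the form at [v], and invertibility bounds [enorm v] by [enorm (B *m v)]. The
    summand 1 in the constant only keeps it invertible. *)
Lemma psd_unit_coercive n (B : 'M[R]_n) : B^T = B ->
  (forall v, 0 <= dotv v (B *m v)) -> B \in unitmx ->
  exists2 c, 0 < c & forall v, c * enorm v ^+ 2 <= dotv v (B *m v).
Proof.
move=> symB B0 uB.
have K0 : 0 < opnorm (invmx B) ^+ 2 * opnorm B + 1.
  by rewrite ltr_wpDl// mulr_ge0 ?sqr_ge0 ?opnorm_ge0.
exists (opnorm (invmx B) ^+ 2 * opnorm B + 1)^-1; first by rewrite invr_gt0.
move=> v; rewrite mulrC ler_pdivrMr//.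
have h1 : enorm (B *m v) ^+ 2 <= opnorm B * dotv v (B *m v).
  have := @psd_cauchy_schwarz n B (B *m v) v symB B0.
  rewrite -enorm_sqr.
  have h2 : dotv (B *m v) (B *m (B *m v)) <= opnorm B * enorm (B *m v) ^+ 2.
    rewrite (le_trans (dotv_le_enorm _ _))// expr2 mulrCA.
    by rewrite ler_wpM2l ?enorm_ge0// enorm_mulmx_le.
  move=> h3; have {h2}h3 := le_trans h3 (ler_wpM2r (B0 v) h2).
  have [->|e0] := eqVneq (enorm (B *m v) ^+ 2) 0.
    by rewrite mulr_ge0 ?opnorm_ge0.
  have {}e0 : 0 < enorm (B *m v) ^+ 2 by rewrite lt_def e0 sqr_ge0.
  by rewrite -(ler_pM2l e0) -expr2 (le_trans h3)// mulrAC mulrC mulrA.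
have h4 : enorm v ^+ 2 <= opnorm (invmx B) ^+ 2 * enorm (B *m v) ^+ 2.
  rewrite -exprMn ler_pXn2r ?nnegrE ?mulr_ge0 ?opnorm_ge0 ?enorm_ge0//.
  by rewrite -{1}(mul1mx v) -(mulVmx uB) -mulmxA enorm_mulmx_le.
rewrite (le_trans h4)//.
have := ler_wpM2l (sqr_ge0 (opnorm (invmx B))) h1.
move=> /le_trans; apply; rewrite mulrDr mulr1 mulrA mulrC lerDl; exact: B0.
Qed.

Lemma eigenvalueNunit n (A : 'M[R]_n) a :
  eigenvalue A a = (A - a%:M \notin unitmx).
Proof. by rewrite /eigenvalue /eigenspace kermx_eq0 row_free_unit. Qed.

Lemma eigenvalue_dotv n (A : 'M[R]_n) a : A^T = A -> eigenvalue A a ->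
  exists2 v, v != 0 & dotv v (A *m v) = a * enorm v ^+ 2.
Proof.
move=> symA /eigenvalueP[w wA w0]; exists w^T.
  by apply: contra w0 => /eqP/(congr1 trmx); rewrite trmxK trmx0 => ->.
by rewrite -{1}symA -trmx_mul wA linearZ /= dotvZr enorm_sqr.
Qed.

(* The infimum of the Rayleigh quotient is an eigenvalue: otherwise [A - a] is
   invertible, hence coercive, and [a] could be increased. *)
Lemma rayleigh_min n (A : 'M[R]_n) : (0 < n)%N -> A^T = A ->
  exists2 a, eigenvalue A a & forall v, a * enorm v ^+ 2 <= dotv v (A *m v).
Proof.
move=> n0 symA.
pose S := [set a : R | forall v, a * enorm v ^+ 2 <= dotv v (A *m v)].
have w0 : exists w : 'cV[R]_n, 0 < enorm w ^+ 2.
  exists (const_mx 1); rewrite exprn_gt0// enorm_gt0; apply/eqP => /matrixP.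
  by move=> /(_ (Ordinal n0) ord0)/eqP; rewrite !mxE oner_eq0.
have supS : has_sup S.
  split.
    exists (- opnorm A) => v /=.
    have := dotv_le_enorm (- v) (A *m v); rewrite dotvNl.
    have := enorm_mulmx_le A v; rewrite -(scaleN1r v) enormZ normrN1 mul1r.
    by have := enorm_ge0 v; nra.
  have [w e0] := w0.
  by exists (dotv w (A *m w) / enorm w ^+ 2) => a /(_ w); rewrite ler_pdivlMr.
have supSS : S (sup S).
  move=> v; have [->|v0] := eqVneq v 0.
    by rewrite enorm0 mulmx0 dotv0r expr0n mulr0.
  have e0 : 0 < enorm v ^+ 2 by rewrite exprn_gt0// enorm_gt0.
  rewrite -ler_pdivlMr//; apply: ge_sup; first by case: supS.
  by move=> a /(_ v); rewrite ler_pdivlMr.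
exists (sup S) => //; rewrite eigenvalueNunit; apply/negP => uA.
have dotB v : dotv v ((A - (sup S)%:M) *m v)
            = dotv v (A *m v) - sup S * enorm v ^+ 2.
  by rewrite mulmxBl dotvDr dotvNr mul_scalar_mx dotvZr enorm_sqr.
have [||c c0 cP] := psd_unit_coercive _ _ uA.
- by rewrite linearB /= tr_scalar_mx symA.
- by move=> v; rewrite dotB subr_ge0; apply: supSS.
suff : sup S + c <= sup S by rewrite gerDl leNgt c0.
apply: ub_le_sup; first by case: supS.
by move=> v; have := cP v; rewrite dotB; lra.
Qed.

Lemma eig_min_le n (A : 'M[R]_n) v : (0 < n)%N -> A^T = A ->
  eig_min A * enorm v ^+ 2 <= dotv v (A *m v).
Proof.
move=> n0 symA; have [a eA aP] := rayleigh_min n0 symA.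
apply: le_trans (aP v); rewrite ler_wpM2r ?sqr_ge0//; apply: ge_inf => //.
exists a => b /eigenvalue_dotv[]// w w0 wE; have := aP w.
by rewrite wE ler_pM2r// exprn_gt0// enorm_gt0.
Qed.

(** The least Rayleigh quotient of [- A] is minus the greatest one of [A]. *)
Lemma eig_max_ge n (A : 'M[R]_n) v : (0 < n)%N -> A^T = A ->
  dotv v (A *m v) <= eig_max A * enorm v ^+ 2.
Proof.
move=> n0 symA; have symNA : (- A)^T = - A by rewrite linearN /= symA.
have [a eA aP] := rayleigh_min n0 symNA.
have {}aP w : dotv w (A *m w) <= - a * enorm w ^+ 2.
  by have := aP w; rewrite mulNmx dotvNr; lra.
apply: le_trans (aP v) _; rewrite ler_wpM2r ?sqr_ge0//; apply: ub_le_sup.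
  exists (- a) => b /eigenvalue_dotv[]// w w0 wE; have := aP w.
  by rewrite wE ler_pM2r// exprn_gt0// enorm_gt0.
move: eA; rewrite /= !eigenvalueNunit; apply: contra.
have -> : - A - a%:M = -1 *: (A - (- a)%:M).
  by rewrite scaleN1r opprB (raddfN scalar_mx) addrC.
by rewrite unitmxZ// unitrN1.
Qed.

Lemma posdefmx_coercive n (A : 'M[R]_n) : posdefmx A ->
  exists2 c, 0 < c & forall v, c * enorm v ^+ 2 <= dotv v (A *m v).
Proof.
move=> [symA A0]; apply: psd_unit_coercive => //.
  move=> v; have [->|v0] := eqVneq v 0; first by rewrite mulmx0 dotv0r.
  by have := A0 v v0; rewrite /dotv -mulmxA => /ltW.
have := eigenvalueNunit A 0; rewrite raddf0 subr0 => /esym/negbRL -> /=.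
apply/negP => /eigenvalue_dotv[]// v /A0; rewrite -mulmxA -/(dotv _ _).
by move=> /lt_eqF/eqP h /esym; rewrite mul0r => /h.
Qed.

End EuclideanGeometry.

(** * The energy of a line *)

Section LinePotential.
Context {R : realType}.
Implicit Types a s t : R.

(** The points [a] and [b] come in any order and the intermediate point is parametrised by [c], so
    that increments of either sign are treated at once. *)
Lemma MVT_between (f df : R -> R) (a b : R) : (forall x : R, is_derive x 1 f (df x)) ->
  exists2 c, 0 <= c <= 1 & f b - f a = df (a + c * (b - a)) * (b - a).
Proof.
move=> fdf.
have fc x : {for x, continuous f}.
  by apply/differentiable_continuous/derivable1_diffP; case: (fdf x).
have H u v : u < v -> exists2 c, 0 <= c <= 1 &
    f v - f u = df (u + c * (v - u)) * (v - u).
  move=> uv; have [|w wuv fE] := @MVT _ f df u v uv (fun x _ => fdf x).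
    exact/continuous_subspaceT.
  move: wuv; rewrite in_itv /= => /andP[uw wv].
  have vu0 : 0 < v - u by rewrite subr_gt0.
  exists ((w - u) / (v - u)).
    by rewrite divr_ge0 ?ler_pdivrMr//; lra.
  by rewrite divfK ?gt_eqF// (addrC u) subrK.
have [ab|ba|->] := ltgtP a b; first exact: H.
- have [c c01 fE] := H b a ba; exists (1 - c); first lra.
  have -> : a + (1 - c) * (b - a) = b + c * (a - b) by ring.
  by rewrite -opprB fE; ring.
- by exists 0; [lra|rewrite !subrr mulr0].
Qed.

(** With [a] the equilibrium angle difference of a line, this is the integrand in its Lyapunov term:
    the two cosine terms of [dhigh] and [phi] cancel. [line_energy] is its antiderivative vanishing
    at 0. *)
Definition line_force a s := s - (sin (a + s) - sin a).
Definition line_energy a s := s ^+ 2 / 2 + cos (a + s) - cos a + sin a * s.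

Lemma is_derive_line_energy a s :
  is_derive s 1 (line_energy a) (line_force a s).
Proof.
rewrite /line_energy /line_force.
by apply: is_derive_eq => /=; rewrite /GRing.scale/=; field.
Qed.

Lemma sin_lipschitz a b : `|sin b - sin a| <= `|b - a|.
Proof.
have [c _ ->] := @MVT_between sin cos a b (fun x => is_derive_sin x).
by rewrite normrM ler_piMl ?normr_ge0// ler_norml cos_geN1 cos_le1.
Qed.

Lemma line_force_sign a s : 0 <= line_force a s * s.
Proof.
have := sin_lipschitz a (a + s); rewrite addrAC subrr add0r /line_force.
have [s0|s0] := leP 0 s.
  by rewrite (ger0_norm s0) ler_norml => /andP[]; nra.
by rewrite (ltr0_norm s0) ler_norml => /andP[]; nra.
Qed.

Lemma line_force_lipschitz a s t :
  `|line_force a t - line_force a s| <= 2 * `|t - s|.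
Proof.
have := sin_lipschitz (a + s) (a + t).
have -> : a + t - (a + s) = t - s by ring.
rewrite /line_force => h.
have -> : t - (sin (a + t) - sin a) - (s - (sin (a + s) - sin a))
        = (t - s) - (sin (a + t) - sin (a + s)) by ring.
by rewrite (le_trans (ler_normB _ _))// mulr2n mulrDl mul1r lerD2l.
Qed.

Lemma line_energy0 a : line_energy a 0 = 0.
Proof. by rewrite /line_energy addr0 expr0n /=; ring. Qed.

(** The force at a nonnegative multiple of [s] has the sign of [s], so the energy does not decrease
    along the ray through [s]. *)
Lemma line_energy_scale a s c : 0 <= c <= 1 ->
  line_energy a (c * s) <= line_energy a s.
Proof.
move=> c01; rewrite -subr_ge0.
have [d d01 ->] := MVT_between (c * s) s (is_derive_line_energy a).
set r := c * s + _.
have -> : r = (c + d * (1 - c)) * s by rewrite /r; ring.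
have := line_force_sign a ((c + d * (1 - c)) * s).
have : 0 <= c + d * (1 - c) by nra.
set e := _ + _; rewrite le_eqVlt => /predU1P[<- _|e0 h].
  by rewrite mul0r /line_force addr0 !subrr mul0r.
have {}h : 0 <= line_force a (e * s) * s.
  by rewrite -(pmulr_lge0 _ e0); rewrite -mulrA (mulrC s).
have -> : s - c * s = (1 - c) * s by ring.
by rewrite mulrCA mulr_ge0//; lra.
Qed.

Lemma line_energy_ge0 a s : 0 <= line_energy a s.
Proof.
by rewrite -(line_energy0 a) -(mul0r s) line_energy_scale// lexx ler01.
Qed.

(** The remainder comes from the mean value theorem and the Lipschitz constant 2 of the force. *)
Lemma line_energy_expansion a s d :
  line_energy a (s + d) <= line_energy a s + line_force a s * d + 2 * d ^+ 2.
Proof.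
have [c c01] := MVT_between s (s + d) (is_derive_line_energy a).
have -> : s + d - s = d by ring.
have := line_force_lipschitz a s (s + c * d).
have -> : s + c * d - s = c * d by ring.
set f := line_force a _; set g := line_force a s => fg h.
suff : (f - g) * d <= 2 * d ^+ 2 by lra.
apply: le_trans (ler_norm _) _; rewrite normrM.
apply: le_trans (ler_wpM2r (normr_ge0 d) fg) _.
rewrite normrM -mulrA ler_pM2l// -mulrA -normrM -expr2 (ger0_norm (sqr_ge0 d)).
by case/andP: c01 => c0 c1; rewrite (ger0_norm c0) ler_piMl// sqr_ge0.
Qed.

(** The bound on the force is asked only on the segment from 0 to [s], which is where the sector
    condition can supply it. *)
Lemma line_energy_le_sqr a s b :
  (forall c, 0 <= c <= 1 -> line_force a (c * s) * (c * s) <= b * (c * s) ^+ 2) ->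
  line_energy a s <= b / 2 * s ^+ 2.
Proof.
move=> H; pose F t := b / 2 * t ^+ 2 - line_energy a t.
have dF t : is_derive t 1 F (b * t - line_force a t).
  have dE := is_derive_line_energy a t; rewrite /F.
  by apply: is_derive_eq => /=; rewrite /GRing.scale/=; field.
have [c c01] := MVT_between 0 s dF.
rewrite /F line_energy0 expr0n/= mulr0 !subr0 add0r => E.
rewrite -subr_ge0 E.
(* The sign of the derivative of [F] is obtained after multiplication by [c], so [c = 0] is a
   separate case, in which the derivative vanishes. *)
have := H c c01; case/andP: c01; rewrite le_eqVlt => /predU1P[<-|c0] c1.
  by move=> _; rewrite mul0r /line_force addr0 !subrr mulr0 subr0 mul0r.
move=> h; rewrite -(pmulr_rge0 _ c0).
have -> : c * ((b * (c * s) - line_force a (c * s)) * s)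
       = b * (c * s) ^+ 2 - line_force a (c * s) * (c * s) by ring.
by rewrite subr_ge0.
Qed.

Lemma continuous_line_force a : continuous (line_force a).
Proof.
move=> s; apply: cvgB; first exact: cvg_id.
apply: cvgB; last exact: cvg_cst.
apply: continuous_comp; last exact: continuous_sin.
by apply: cvgD; [exact: cvg_cst|exact: cvg_id].
Qed.

Lemma continuous_line_energy a : continuous (line_energy a).
Proof.
move=> s; apply/differentiable_continuous/derivable1_diffP.
by case: (is_derive_line_energy a s).
Qed.

Lemma oriented_integral_line_force a s :
  oriented_integral 0 s (line_force a) = line_energy a s.
Proof.
have FTC u v : u < v -> Rintegral lebesgue_measure `[u, v] (line_force a)
    = line_energy a v - line_energy a u.
  move=> uv; rewrite /Rintegral (@continuous_FTC2 _ _ (line_energy a))//.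
  - exact/continuous_subspaceT/continuous_line_force.
  - split.
    + by move=> x _; case: (is_derive_line_energy a x).
    + by apply: cvg_at_right_filter; exact: continuous_line_energy.
    + by apply: cvg_at_left_filter; exact: continuous_line_energy.
  - move=> x _; rewrite derive1E.
    by case: (is_derive_line_energy a x).
rewrite /oriented_integral; case: ltgtP => [s0|s0|<-].
- by rewrite FTC// line_energy0 subr0.
- by rewrite FTC// line_energy0 sub0r opprK.
- by rewrite set_itv1 Rintegral_set1 line_energy0.
Qed.

End LinePotential.

(** * The Lyapunov function *)

Section PowerSystem.
Context {R : realType} {n m : nat} (G : power_system R n m).
Implicit Types (x d : 'cV[R]_(n + n)) (k : 'I_m).

Local Notation dth k := (line_diff G (theq G) k).

Lemma sum_at_node (v : 'cV[R]_n) (u : node n) :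
  \sum_i (u == Some i)%:R * v i ord0 = at_node v u.
Proof.
case: u => [i|]; last by rewrite big1// => i _; rewrite mul0r.
rewrite (bigD1 i)//= eqxx mul1r big1 ?addr0// => j ji.
by rewrite (inj_eq Some_inj) eq_sym (negbTE ji) mul0r.
Qed.

Lemma incidence_trmulE (v : 'cV[R]_n) k :
  ((incidence G)^T *m v) k ord0 = line_diff G v k.
Proof.
rewrite mxE /line_diff -!sum_at_node -sumrB; apply: eq_bigr => i _.
by rewrite !mxE mulrBl.
Qed.

Lemma Cmx_mulE x : Cmx G *m x = (incidence G)^T *m usubmx x.
Proof. by rewrite -{1}(vsubmxK x) mul_row_col mul0mx addr0. Qed.

Lemma Cmx_coordE x k : (Cmx G *m x) k ord0 = line_diff G (usubmx x) k.
Proof. by rewrite Cmx_mulE incidence_trmulE. Qed.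

Lemma line_diffD u v k : line_diff G (u + v) k = line_diff G u k + line_diff G v k.
Proof. by rewrite -!incidence_trmulE mulmxDr mxE. Qed.

Lemma line_diffZ (c : R) v k : line_diff G (c *: v) k = c * line_diff G v k.
Proof. by rewrite -!incidence_trmulE -scalemxAr mxE. Qed.

Lemma line_diff_angles x k :
  line_diff G (angles G x) k = dth k + (Cmx G *m x) k ord0.
Proof. by rewrite line_diffD Cmx_coordE. Qed.

(** The output reads angles only, while the nonlinearity enters the frequency equation only; the
    same holds for the disturbance below. The line energies are thus differentiated along
    [Amx G *m x] alone. *)
Lemma Cmx_Bmx : Cmx G *m Bmx G = 0.
Proof. by rewrite mul_row_col mulmx0 mul0mx addr0. Qed.

Lemma Cmx_Hmx : Cmx G *m Hmx G = 0.
Proof. by rewrite mul_row_col mulmx0 mul0mx addr0. Qed.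

Lemma dhigh_sub_phi k s : dhigh G k * s - phi G k s = line_force (dth k) s.
Proof. by rewrite /dhigh /phi /line_force; ring. Qed.

(** The undisturbed part of the field is split off because it is continuous along a trajectory,
    whereas the disturbance is controlled only almost everywhere. *)
Definition drift x : 'cV[R]_(n + n) :=
  Amx G *m x - Bmx G *m phi_vec G (Cmx G *m x).

Lemma lure_fieldE x u : lure_field G x u = drift x + Hmx G *m u.
Proof. by []. Qed.

Lemma lure_field_usub x u : usubmx (lure_field G x u) = freqs x.
Proof.
rewrite /lure_field !linearD !linearN /= /Amx /Bmx /Hmx -{1}(vsubmxK x).
rewrite mul_block_col !mul_col_mx !col_mxKu !mul0mx mul1mx.
by rewrite oppr0 !addr0 add0r.
Qed.

Section Lyapunov.
Context (P : 'M[R]_(n + n)) (lam : 'I_m -> R).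
Local Notation V := (Lyap G P lam).

Definition line_forces x : 'cV[R]_m :=
  \col_k line_force (dth k) ((Cmx G *m x) k ord0).

Definition lyap_grad x : 'cV[R]_(n + n) :=
  2 *: (P *m x + (Cmx G)^T *m (diag_mx (\row_k lam k) *m line_forces x)).

Lemma LyapE x : V x = dotv x (P *m x)
  + 2 * \sum_(k < m) lam k * line_energy (dth k) ((Cmx G *m x) k ord0).
Proof.
rewrite /Lyap /dotv mulmxA; congr (_ + 2 * _); apply: eq_bigr => k _.
rewrite -oriented_integral_line_force; congr (_ * oriented_integral _ _ _).
by apply/funext => s; rewrite dhigh_sub_phi.
Qed.

Lemma Lyap0 : V 0 = 0.
Proof.
rewrite LyapE !mulmx0 dotv0r big1 ?mulr0 ?addr0// => k _.
by rewrite mxE line_energy0 mulr0.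
Qed.

Hypothesis lam0 : forall k, 0 <= lam k.
Hypothesis posP : posdefmx P.

Let symP : P^T = P. Proof. by case: posP. Qed.
Let dotP_gt0 x : x != 0 -> 0 < dotv x (P *m x).
Proof. by move=> x0; have := posP.2 _ x0; rewrite -mulmxA. Qed.

Lemma Lyap_ge x : dotv x (P *m x) <= V x.
Proof.
rewrite LyapE lerDl mulr_ge0//; apply: sumr_ge0 => k _.
by rewrite mulr_ge0// line_energy_ge0.
Qed.

(** The quadratic part decreases strictly and the line energies do not increase. This radial
    monotonicity is what allows a state to be pushed onto a face, or into an open sublevel set, at a
    lower value of [V]. *)
Lemma Lyap_scale_lt c x : 0 <= c < 1 -> x != 0 -> V (c *: x) < V x.
Proof.
move=> /andP[c0 c1] x0; rewrite !LyapE; apply: ltr_leD.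
  by rewrite -scalemxAr !dotv_linear mulrA gtr_pMl ?dotP_gt0//; nra.
rewrite ler_pM2l//; apply: ler_sum => k _; apply: ler_wpM2l => //.
by rewrite -scalemxAr mxE line_energy_scale// c0 ltW.
Qed.

(** The quadratic part expands exactly and each line energy has a remainder uniform in the state;
    the factor 4 is the 2 in [V] times the 2 of [line_energy_expansion]. *)
Lemma Lyap_expansion : exists2 K, 0 <= K & forall x d,
  V (x + d) <= V x + dotv (lyap_grad x) d + K * enorm d ^+ 2.
Proof.
exists (opnorm P + 4 * \sum_k lam k * opnorm (Cmx G) ^+ 2).
  rewrite addr_ge0 ?opnorm_ge0// mulr_ge0//; apply: sumr_ge0 => k _.
  by rewrite mulr_ge0// sqr_ge0.
move=> x d; rewrite !LyapE !mulmxDr.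
have Pd : dotv d (P *m d) <= opnorm P * enorm d ^+ 2.
  rewrite (le_trans (dotv_le_enorm _ _))// expr2 mulrCA.
  by rewrite ler_wpM2l ?enorm_ge0// enorm_mulmx_le.
have xPd : dotv d (P *m x) = dotv x (P *m d).
  by rewrite dotv_trmx symP dotvC.
have -> : dotv (lyap_grad x) d = 2 * dotv x (P *m d) +
    2 * \sum_k lam k * line_force (dth k) ((Cmx G *m x) k ord0)
          * (Cmx G *m d) k ord0.
  rewrite /lyap_grad dotvZl dotvDl mulrDr -dotv_trmx; congr (_ * _ + _ * _).
    by rewrite dotvC.
  rewrite dotvE; apply: eq_bigr => k _; rewrite mul_diag_mx !mxE.
  by [].
have E : \sum_k lam k * line_energy (dth k) ((Cmx G *m x + Cmx G *m d) k ord0)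
   <= \sum_k lam k * line_energy (dth k) ((Cmx G *m x) k ord0)
    + \sum_k lam k * line_force (dth k) ((Cmx G *m x) k ord0)
          * (Cmx G *m d) k ord0
    + (2 * \sum_k lam k * opnorm (Cmx G) ^+ 2) * enorm d ^+ 2.
  rewrite -mulrA mulr_suml mulr_sumr -!big_split; apply: ler_sum => k _ /=.
  have := line_energy_expansion (dth k) ((Cmx G *m x) k ord0) ((Cmx G *m d) k ord0).
  rewrite [(_ + _ *m d) k ord0]mxE; set e := line_energy _ _; set e0 := line_energy _ _.
  set f := line_force _ _; set z := (Cmx G *m d) k ord0 => h.
  have z2 : z ^+ 2 <= opnorm (Cmx G) ^+ 2 * enorm d ^+ 2.
    have := le_trans (coord_le_enorm (Cmx G *m d) k) (enorm_mulmx_le _ _).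
    rewrite -exprMn -/z -[z ^+ 2]real_normK ?num_real//.
    by rewrite ler_pXn2r ?nnegrE ?mulr_ge0 ?opnorm_ge0 ?enorm_ge0.
  have {}h : e <= e0 + f * z + 2 * (opnorm (Cmx G) ^+ 2 * enorm d ^+ 2) by lra.
  by apply: le_trans (ler_wpM2l (lam0 k) h) _; rewrite le_eqVlt; apply/orP; left;
    apply/eqP; ring.
by rewrite !dotv_linear xPd; lra.
Qed.

End Lyapunov.
End PowerSystem.

(** * Sector bounds and dissipation *)

Section Dissipation.
Context {R : realType} {n m : nat} (G : power_system R n m).
Context (thbar dlow : 'I_m -> R) (P : 'M[R]_(n + n)) (lam : 'I_m -> R).
Implicit Types (x : 'cV[R]_(n + n)) (k : 'I_m).
Local Notation V := (Lyap G P lam).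
Local Notation dth k := (line_diff G (theq G) k).

Hypothesis n0 : (0 < n)%N.
Hypothesis lam0 : forall k, 0 <= lam k.
Hypothesis posP : posdefmx P.
Hypothesis sectorG : sector_bound G thbar dlow.
Hypothesis theq_lt : forall k, `|dth k| < thbar k.

Let symP : P^T = P. Proof. by case: posP. Qed.

(** The polytope is convex and contains the origin, since the equilibrium angles satisfy the
    bounds. *)
Lemma Pset_scale c x : 0 <= c <= 1 -> Pset G thbar x -> Pset G thbar (c *: x).
Proof.
move=> /andP[c0 c1] xP k; rewrite line_diff_angles -scalemxAr mxE.
have := xP k; have := theq_lt k; rewrite line_diff_angles ler_norml ltr_norml.
by set a := dth k; set z := (_ *m _) k _; rewrite ler_norml; nra.
Qed.

(** The sector condition in product form makes sense at [z = 0] as well and is quadratic in [z] and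
    [phi], as the S-procedure requires. *)
Lemma sector_phi x k : Pset G thbar x -> let z := (Cmx G *m x) k ord0 in
  0 <= (phi G k z - dlow k * z) * (dhigh G k * z - phi G k z).
Proof.
move=> /sectorG/(_ k)/=; set z := (Cmx G *m x) k ord0.
have [->|z0] := eqVneq z 0.
  by rewrite /phi addr0 !mulr0 !subrr mulr0.
move=> /(_ isT)/andP[].
have -> : phi G k z = phi G k z / z * z by rewrite divfK.
rewrite mulfK//; set q := phi G k z / z => h1 h2.
have -> : (q * z - dlow k * z) * (dhigh G k * z - q * z)
  = (q - dlow k) * (dhigh G k - q) * z ^+ 2 by ring.
by rewrite mulr_ge0 ?sqr_ge0// mulr_ge0// subr_ge0.
Qed.

Lemma line_force_le_sector x k : Pset G thbar x -> let z := (Cmx G *m x) k ord0 in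
  line_force (dth k) z * z <= (dhigh G k - dlow k) * z ^+ 2.
Proof.
move=> /sectorG/(_ k)/=; set z := (Cmx G *m x) k ord0.
have [->|z0] := eqVneq z 0; first by rewrite mulr0 expr0n/= mulr0.
move=> /(_ isT)/andP[+ _]; rewrite -dhigh_sub_phi => h.
have -> : (dhigh G k * z - phi G k z) * z
   = (dhigh G k - phi G k z / z) * z ^+ 2 by field.
by rewrite ler_wpM2r ?sqr_ge0// lerB.
Qed.

Lemma line_energy_le_sector x k : Pset G thbar x -> let z := (Cmx G *m x) k ord0 in
  line_energy (dth k) z <= (dhigh G k - dlow k) / 2 * z ^+ 2.
Proof.
move=> xP /=; apply: line_energy_le_sqr => c c01.
by have := line_force_le_sector k (Pset_scale c01 xP); rewrite -scalemxAr mxE.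
Qed.

Hypothesis dlow_le : forall k, dlow k <= dhigh G k.

Lemma mu_const_ge k : lam k * (dhigh G k - dlow k) <= mu_const G dlow lam.
Proof.
apply: ub_le_sup; last by exists k.
exists (\sum_k lam k * (dhigh G k - dlow k)) => _ [l _ <-].
rewrite (bigD1 l)//= lerDl; apply: sumr_ge0 => j _.
by rewrite mulr_ge0// subr_ge0.
Qed.

Lemma mu_const_ge0 : 0 <= mu_const G dlow lam.
Proof.
have [[k _]|E] := pselect (exists k : 'I_m, True).
  by apply: le_trans (mu_const_ge k); rewrite mulr_ge0// subr_ge0.
(* Without lines the supremum ranges over the empty set and takes the default value 0. *)
rewrite /mu_const (_ : [set _ | _ in _] = set0) ?sup0//.
by apply/seteqP; split => // y [k _ _]; apply: E; exists k.
Qed.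

Lemma Lyap_le x : Pset G thbar x ->
  V x <= (eig_max P + mu_const G dlow lam * opnorm (Cmx G) ^+ 2) * enorm x ^+ 2.
Proof.
move=> xP; rewrite LyapE [leRHS]mulrDl; apply: lerD.
  by rewrite eig_max_ge// addn_gt0 n0.
have -> : mu_const G dlow lam * opnorm (Cmx G) ^+ 2 * enorm x ^+ 2
    = mu_const G dlow lam * (opnorm (Cmx G) * enorm x) ^+ 2 by ring.
have : enorm (Cmx G *m x) ^+ 2 <= (opnorm (Cmx G) * enorm x) ^+ 2.
  rewrite ler_pXn2r ?nnegrE ?mulr_ge0 ?opnorm_ge0 ?enorm_ge0//.
  exact: enorm_mulmx_le.
move=> /(ler_wpM2l mu_const_ge0); apply: le_trans.
rewrite enorm_sqr dotvE !mulr_sumr; apply: ler_sum => k _.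
have := ler_wpM2l (lam0 k) (line_energy_le_sector k xP).
set z := (Cmx G *m x) k ord0 => h.
have := ler_wpM2r (sqr_ge0 z) (mu_const_ge k); rewrite -[z * z]expr2; lra.
Qed.

Context (Gam : 'M[R]_m).
Hypothesis diagGam : is_diag_mx Gam.
Hypothesis posGam : posdefmx Gam.
Local Notation Rm := (Rmx G dlow P lam Gam).
Local Notation sigma := (eig_min (- Rm)).
Hypothesis negR : negdefmx Rm.

Lemma is_diag_mx_row : exists2 g : 'rV[R]_m,
  Gam = diag_mx g & forall k, 0 <= g ord0 k.
Proof.
have /is_diag_mxP GamP := diagGam.
exists (\row_k Gam k k).
  apply/matrixP => i j; rewrite !mxE.
  by case: eqVneq => [->|ij]; rewrite ?mulr1n// mulr0n GamP.
move=> k; rewrite mxE.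
have [_] := posGam.
have e0 : (delta_mx k ord0 : 'cV[R]_m) != 0.
  by apply/eqP => /matrixP/(_ k ord0)/eqP; rewrite !mxE !eqxx oner_eq0.
move=> /(_ _ e0)/ltW; rewrite -mulmxA -colE.
by rewrite -/(dotv _ _) dotvE (bigD1 k)//= !mxE !eqxx mul1r big1 ?addr0// => i
  /negbTE ik;
   rewrite !mxE ik mul0r.
Qed.

(* The S-procedure: the sector inequalities, weighted by the diagonal
   of [Gam], are absorbed into the quadratic form of [Rmx]. *)
Lemma lyap_grad_drift x : Pset G thbar x ->
  dotv (lyap_grad G P lam x) (drift G x)
  <= dotv (col_mx x (phi_vec G (Cmx G *m x)))
          (Rm *m col_mx x (phi_vec G (Cmx G *m x))).
Proof.
move=> xP; have [g GamE g0] := is_diag_mx_row.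
set z := Cmx G *m x; set f := phi_vec G z.
set La := diag_mx (\row_k lam k); set Dl := diag_mx (\row_k dlow k).
set Dh := diag_mx (\row_k dhigh G k).
have line_forcesE : line_forces G x = Dh *m z - f.
  apply/matrixP => k j; rewrite ord1 mul_diag_mx !mxE -dhigh_sub_phi.
  by rewrite -/z.
have -> : dotv (lyap_grad G P lam x) (drift G x) =
   2 * (dotv x (P *m (Amx G *m x)) - dotv x (P *m (Bmx G *m f))
     + dotv (Cmx G *m (Amx G *m x)) (La *m (Dh *m z))
     - dotv (Cmx G *m (Amx G *m x)) (La *m f)).
  have -> : lyap_grad G P lam x = 2 *: (P^T *m x + (Cmx G)^T *m (La *m (Dh *m z - f))).
    by rewrite symP -line_forcesE.
  rewrite dotvZl dotvDl -!dotv_trmx /drift -/f !mulmxBr.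
  rewrite [Cmx G *m (Bmx G *m f)]mulmxA Cmx_Bmx mul0mx subr0.
  by rewrite !dotv_linear [dotv (La *m _) _]dotvC [dotv (La *m f) _]dotvC; ring.
have -> : Rm *m col_mx x f = col_mx
   ((Amx G)^T *m (P *m x) + (Amx G)^T *m ((Cmx G)^T *m (La *m (Dh *m z)))
    + P *m (Amx G *m x) + (Cmx G)^T *m (Dh *m (La *m (Cmx G *m (Amx G *m x))))
    - 2 *: ((Cmx G)^T *m (Dl *m (Gam *m (Dh *m z))))
    - P *m (Bmx G *m f) - (Amx G)^T *m ((Cmx G)^T *m (La *m f))
    + (Cmx G)^T *m ((Dl + Dh) *m (Gam *m f)))
   ((- (P *m Bmx G) - (Amx G)^T *m (Cmx G)^T *m La
      + (Cmx G)^T *m (Dl + Dh) *m Gam)^T *m x - 2 *: (Gam *m f)).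
  rewrite /Rmx mul_block_col; congr col_mx; last first.
    by rewrite mulNmx scalemxAl.
  rewrite -/La -/Dl -/Dh !(mulmxDl, mulmxDr, mulNmx) -!scalemxAl -!mulmxA.
  by rewrite -/z !addrA.
rewrite dotv_col !dotvDr !dotvNr !dotvZr.
have tr1 (y : 'cV[R]_(n + n)) (w : 'cV[R]_(n + n)) : dotv w ((Amx G)^T *m y) = dotv
  (Amx G *m w) y.
  by rewrite dotv_trmx trmxK.
have tr2 (w : 'cV[R]_(n + n)) (y : 'cV[R]_m) : dotv w ((Cmx G)^T *m y) = dotv (Cmx G
  *m w) y.
  by rewrite dotv_trmx trmxK.
rewrite !tr1 !tr2 -/z.
rewrite [dotv f (_^T *m x)]dotv_trmx trmxK [dotv (_ *m f) x]dotvC.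
rewrite !mulmxDl !mulNmx -!mulmxA !(dotvDr, dotvNr) !tr1 !tr2 -/z.
rewrite !mulmxDl !dotvDr.
set y := Cmx G *m (Amx G *m x).
have -> : dotv z (Dh *m (La *m y)) = dotv y (La *m (Dh *m z)).
  rewrite !dotvE; apply: eq_bigr => k _; rewrite !mul_diag_mx !mxE; ring.
have -> : dotv (Amx G *m x) (P *m x) = dotv x (P *m (Amx G *m x)).
  by rewrite [RHS]dotv_trmx symP dotvC.
(* Twice this quantity is the right-hand side minus the left-hand side; coordinate by coordinate it
   is [g] times the product in [sector_phi]. *)
have : 0 <= dotv z (Dl *m (Gam *m f)) + dotv z (Dh *m (Gam *m f))
  - dotv z (Dl *m (Gam *m (Dh *m z))) - dotv f (Gam *m f).
  rewrite GamE !dotvE -!big_split /= -!sumrB; apply: sumr_ge0 => k _.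
  have /= := mulr_ge0 (g0 k) (sector_phi k xP).
  rewrite !mul_diag_mx !mxE -/z /=.
  by move=> h; apply: le_trans h _; rewrite le_eqVlt; apply/orP; left; apply/eqP; ring.
lra.
Qed.

Hypothesis sigma0 : 0 <= sigma.

(** The drift contributes at most [- sigma] times the squared norm of the pair of [x] and [phi],
    which dominates that of [x]. The disturbance acts through [P *m Hmx G] only, because
    [Cmx G *m Hmx G = 0]. *)
Lemma dissipation x u : Pset G thbar x ->
  dotv (lyap_grad G P lam x) (lure_field G x u)
  <= - sigma * enorm x ^+ 2 + 2 * opnorm (P *m Hmx G) * enorm x * enorm u.
Proof.
move=> xP; rewrite lure_fieldE dotvDr; apply: lerD.
  apply: le_trans (lyap_grad_drift xP) _.
  set w := col_mx _ _.
  have := @eig_min_le R _ (- Rm) w; rewrite !addn_gt0 n0 => /(_ isT negR.1).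
  rewrite mulNmx dotvNr.
  have : enorm x ^+ 2 <= enorm w ^+ 2.
    by rewrite !enorm_sqr dotv_col lerDl dotvv_ge0.
  by move=> /(ler_wpM2l sigma0); lra.
rewrite /lyap_grad dotvZl dotvDl -dotv_trmx mulmxA Cmx_Hmx mul0mx dotv0r.
rewrite addr0 -{1}symP -dotv_trmx mulmxA -!mulrA ler_pM2l//.
rewrite (le_trans (dotv_le_enorm _ _))// mulrCA ler_wpM2l ?enorm_ge0//.
exact: enorm_mulmx_le.
Qed.

End Dissipation.

(** * Caratheodory trajectories *)

Section Trajectory.
Context {R : realType}.
Local Notation mu := (@lebesgue_measure R).

Lemma ae_le_Rintegral (D : set R) (f g : R -> R) : measurable D ->
  mu.-integrable D (EFin \o f) -> mu.-integrable D (EFin \o g) ->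
  {ae mu, forall t, D t -> f t <= g t} ->
  Rintegral mu D f <= Rintegral mu D g.
Proof.
move=> mD fi gi [N [mN muN fgN]].
rewrite /Rintegral (negligible_integral mN mD fi muN).
rewrite (negligible_integral mN mD gi muN).
have mDN : measurable (D `\` N) by exact: measurableD.
apply: le_Rintegral => //; [exact: integrableS fi|exact: integrableS gi|].
by move=> t [Dt Nt]; apply: contrapT => fgt; apply: Nt; apply: fgN => /(_ Dt).
Qed.

Lemma ae_sub (A B : R -> Prop) : (forall t, A t -> B t) ->
  {ae mu, forall t, A t} -> {ae mu, forall t, B t}.
Proof.
move=> AB [N [mN muN AN]]; exists N; split => // t nBt.
by apply: AN => /AB.
Qed.

Lemma Linfty_norm_lt n (u : R -> 'cV[R]_n) (M : R) : (Linfty_norm u < M%:E)%E ->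
  exists2 c, 0 <= c < M & {ae mu, forall t, 0 <= t -> enorm (u t) <= c}.
Proof.
rewrite /Linfty_norm; set nu := mrestr _ _; set L := ess_sup _ _ => LM.
have L0 : (0 <= L)%E.
  apply: ess_sup_gee.
    suff : (0 < mu ([set: R] `&` `[0%R, +oo[))%E by [].
    by rewrite setTI lebesgue_measure_itv /= ltry addye ?ltry.
  by apply: nearW => t; rewrite lee_fin enorm_ge0.
have Lfin : L \is a fin_num.
  by rewrite ge0_fin_numE// (lt_trans LM)// ltry.
exists (fine L); first by rewrite fine_ge0//= -lte_fin fineK.
have [N [mN nuN hN]] := ess_sup_ge nu (fun t => (enorm (u t))%:E).
(* A null set of the measure restricted to the half-line has a Lebesgue-null trace there, and the
   claim concerns nonnegative times only. *)
exists (N `&` `[0, +oo[%classic); split => //; first exact: measurableI.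
move=> t /= /not_implyP[t0 ht]; split; last by rewrite /= in_itv /= t0.
by apply: hN => /=; rewrite -/L -(fineK Lfin) lee_fin.
Qed.

Definition ccontinuous k (f : R -> 'cV[R]_k) :=
  forall i, continuous (fun t => f t i ord0).

Lemma continuous_sumr (I : Type) (r : seq I) (F : I -> R -> R) :
  (forall i, continuous (F i)) -> continuous (fun t => \sum_(i <- r) F i t).
Proof.
move=> Fc; elim: r => [|i r IH] t.
  by rewrite (_ : (fun _ => _) = fun=> 0) ?cvg_cst//; [exact: cvg_cst|apply/funext =>
    s; rewrite big_nil].
rewrite (_ : (fun _ => _) = (fun s => F i s + \sum_(j <- r) F j s)).
  by apply: cvgD; [exact: Fc|exact: IH].
by apply/funext => s; rewrite big_cons.
Qed.

Lemma ccontinuous_mulmx k l (A : 'M[R]_(l, k)) f :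
  ccontinuous f -> ccontinuous (fun t => A *m f t).
Proof.
move=> fc i; rewrite (_ : (fun _ => _) = fun t => \sum_j A i j * f t j ord0).
  by apply: continuous_sumr => j t; apply: cvgM; [exact: cvg_cst|exact: fc].
by apply/funext => t; rewrite mxE.
Qed.

Lemma continuous_dotv k (f g : R -> 'cV[R]_k) :
  ccontinuous f -> ccontinuous g -> continuous (fun t => dotv (f t) (g t)).
Proof.
move=> fc gc; rewrite (_ : (fun _ => _) = fun t => \sum_j f t j ord0 * g t j ord0).
  by apply: continuous_sumr => j t; apply: cvgM; [exact: fc|exact: gc].
by apply/funext => t; rewrite dotvE.
Qed.

Lemma ccontinuous_cst k (v : 'cV[R]_k) : ccontinuous (fun=> v).
Proof. by move=> i t; exact: cvg_cst. Qed.

Context {n m : nat} (G : power_system R n m).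
Context (eta : R -> 'cV[R]_n) (x : R -> 'cV[R]_(n + n)).
Hypothesis traj : is_trajectory G eta x.

(* [is_trajectory] only constrains [x] on [0, +oo[; composing with the absolute
   value gives a function that is continuous everywhere. *)
Lemma traj_continuous : ccontinuous (fun t : R => x `|t|).
Proof.
(* The interval of integration reaches beyond [|t|], so it contains [|s|] for all [s] near [t]. *)
move=> i t; pose T := `|t| + 1.
have T0 : 0 <= T by rewrite addr_ge0.
pose f (s : R) := lure_field G (x s) (eta s) i ord0.
have [fi _] := traj T0 i.
have /subspace_continuousP/(_ `|t|) := parameterized_integral_continuous T0 fi.
move=> /(_ _)/wrap[|H]; first by rewrite /= in_itv /= normr_ge0/= lerDl.
rewrite (_ : (fun _ => _) = fun s => x 0 i ord0 + parameterized_integral mu 0 `|s|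
  f); last first.
  by apply/funext => s; have [_ ->] := traj (normr_ge0 s) i.
apply: cvgD; first exact: cvg_cst.
apply: cvg_comp H => U /= [e /= e0 eU].
have nt := @norm_continuous _ R^o t.
have /cvgrPdist_lt/(_ _ e0) h1 := nt.
have /cvgrPdist_lt/(_ _ ltr01) h2 := nt.
near=> s; apply: eU => /=; first by near: s.
rewrite in_itv /= normr_ge0 /= /T.
have : `| `|t| - `|s| | < 1 by near: s.
by rewrite ltr_norml; lra.
Unshelve. all: by end_near. Qed.

(** As [p] is fixed, pairing with it commutes with integration, so an almost everywhere bound on the
    paired field integrates to a bound on the increment. *)
Lemma traj_increment_le (p : 'cV[R]_(n + n)) s t c : 0 <= s -> s <= t ->
  {ae mu, forall r, s <= r <= t -> dotv p (lure_field G (x r) (eta r)) <= c} ->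
  dotv p (x t - x s) <= c * (t - s).
Proof.
move=> s0 st Hae; have t0 := le_trans s0 st.
pose f i (r : R) := lure_field G (x r) (eta r) i ord0.
pose g (r : R) := dotv p (lure_field G (x r) (eta r)).
have gE : EFin \o g = fun r => (\sum_i (p i ord0 * f i r)%:E)%E.
  by apply/funext => r /=; rewrite /g dotvE sumEFin.
have pfi T : 0 <= T -> forall i, mu.-integrable `[0, T] (fun r => (p i ord0 * f i
  r)%:E).
  move=> T0 i; have [fi _] := traj T0 i.
  by have := @integrableZl _ _ _ mu _ _ (p i ord0) _ fi; apply.
have gi T : 0 <= T -> mu.-integrable `[0, T] (EFin \o g).
  by move=> T0; rewrite gE; apply: integrable_sum => // i _; exact: pfi.
have gI T : 0 <= T -> dotv p (x T) - dotv p (x 0) = Rintegral mu `[0, T] g.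
  move=> T0; rewrite (_ : Rintegral _ _ _ = fine (integral mu `[0, T] (EFin \o g)))//.
  rewrite gE integral_sum//; last exact: pfi.
  rewrite !dotvE -sumrB (eq_bigr (fun i => (Rintegral mu `[0, T] (fun r => p i ord0 *
    f i r))%:E)); last first.
    by move=> i _; rewrite /Rintegral fineK//; apply: integrable_fin_num => //;
      exact: pfi.
  rewrite sumEFin /=; apply: eq_bigr => i _.
  have [fi ->] := traj T0 i.
  by rewrite RintegralZl//; ring.
have -> : dotv p (x t - x s) = Rintegral mu `[0, t] g - Rintegral mu `[0, s] g.
  by rewrite -!gI// dotvDr dotvNr; ring.
rewrite Rintegral_itvB ?bnd_simp//; last exact: gi.
have mst : measurable (`]s, t] : set R) by [].
have -> : c * (t - s) = Rintegral mu `]s, t] (cst c).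
  rewrite Rintegral_cst//= lebesgue_measure_itv /= lte_fin.
  have [//|ts] := ltP s t.
  by rewrite (@le_anti _ _ s t) ?subrr// st.
apply: ae_le_Rintegral => //.
- apply: integrableS (gi _ t0) => //.
  by apply: subset_itv; rewrite bnd_simp.
- apply: (@integrableS _ _ _ mu `[s, t]) => //.
    exact: subset_itv_oc_cc.
  apply: continuous_compact_integrable; first exact: segment_compact.
  by apply: continuous_subspaceT => r; exact: cvg_cst.
- case: Hae => N [mN muN hN]; exists N; split => //.
  apply: subset_trans hN => r /= hr h; apply: hr; rewrite in_itv /= => /andP[sr rt].
  by apply: h; rewrite ltW.
Qed.

(** * Increments of the outputs and of [V] under a bounded disturbance *)

Section Bounded.
Context (c : R).
Hypothesis c0 : 0 <= c.
Hypothesis etac : {ae mu, forall t, 0 <= t -> enorm (eta t) <= c}.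

Lemma ccontinuous_drift : ccontinuous (fun t : R => drift G (x `|t|)).
Proof.
move=> i; rewrite (_ : (fun _ => _) = fun t => (Amx G *m x `|t|) i ord0
     - (Bmx G *m phi_vec G (Cmx G *m x `|t|)) i ord0); last first.
  by apply/funext => t; rewrite /drift !mxE.
move=> t; apply: cvgB; first exact: (@ccontinuous_mulmx _ _ (Amx G) _ traj_continuous).
apply: (@ccontinuous_mulmx _ _ (Bmx G)) => k {}t.
rewrite (_ : (fun _ => _) = fun s : R => phi G k ((Cmx G *m x `|s|) k ord0)); last
  first.
  by apply/funext => s; rewrite mxE.
have zc : {for t, continuous (fun s : R => (Cmx G *m x `|s|) k ord0)}.
  exact: (@ccontinuous_mulmx _ _ (Cmx G) _ traj_continuous).
rewrite /phi; apply: cvgB; last by apply: cvgM; [exact: cvg_cst|exact: zc].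
apply: cvgB; last exact: cvg_cst.
apply: (@continuous_comp _ _ _ (fun s : R => line_diff G (theq G) k + (Cmx G *m x
  `|s|) k ord0) sin).
  by apply: cvgD; [exact: cvg_cst|exact: zc].
exact: continuous_sin.
Qed.

(** The angle differences are driven by the frequencies alone, so the disturbance does not appear;
    [sg] serves both faces of a line. *)
Lemma line_diff_increment_le (sg : R) k s t a : 0 <= s -> s <= t ->
  (forall r, s <= r <= t -> sg * line_diff G (freqs (x r)) k <= a) ->
  sg * (Cmx G *m x t) k ord0 - sg * (Cmx G *m x s) k ord0 <= a * (t - s).
Proof.
move=> s0 st H; pose e : 'cV[R]_m := delta_mx k ord0.
have dote v : dotv ((Cmx G)^T *m (sg *: e)) v = sg * (Cmx G *m v) k ord0.
  rewrite -dotv_trmx dotvZl; congr (_ * _).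
  rewrite dotvE (bigD1 k)//= big1 ?addr0; first by rewrite !mxE !eqxx mul1r.
  by move=> i /negbTE ik; rewrite !mxE ik mul0r.
rewrite -!dote.
have := @traj_increment_le ((Cmx G)^T *m (sg *: e)) s t a s0 st.
rewrite dotvDr dotvNr; apply.
apply: nearW => r rst; rewrite dote Cmx_coordE lure_field_usub; exact: H.
Qed.

Context (P : 'M[R]_(n + n)) (lam : 'I_m -> R).
Local Notation V := (Lyap G P lam).
Hypothesis lam0 : forall k, 0 <= lam k.
Hypothesis posP : posdefmx P.

Lemma continuous_Lyap : continuous (fun t : R => V (x `|t|)).
Proof.
rewrite (_ : (fun _ => _) = fun t : R => dotv (x `|t|) (P *m x `|t|)
  + 2 * \sum_(k < m) lam k * line_energy (line_diff G (theq G) k) ((Cmx G *m x `|t|)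
    k ord0)); last first.
  by apply/funext => t; rewrite LyapE.
have xc := traj_continuous.
move=> t; apply: cvgD.
  by apply: continuous_dotv => //; exact: ccontinuous_mulmx.
apply: cvgM; first exact: cvg_cst.
apply: continuous_sumr => k {}t; apply: cvgM; first exact: cvg_cst.
apply: (@continuous_comp _ _ _ (fun s : R => (Cmx G *m x `|s|) k ord0)).
  exact: (@ccontinuous_mulmx _ _ (Cmx G) _ xc).
exact: continuous_line_energy.
Qed.

Lemma Lyap_right_increment (s W : R) : 0 <= s ->
  (forall u, enorm u <= c -> dotv (lyap_grad G P lam (x s)) (lure_field G (x s) u) <=
    W) ->
  forall e : R, 0 < e -> exists2 d : R, 0 < d &
    forall t : R, s <= t -> t < s + d -> V (x t) - V (x s) <= (W + e) * (t - s).
Proof.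
move=> s0 HW e e0; set p := lyap_grad G P lam (x s).
have [M M0 VM] := Lyap_expansion G lam0 posP.
have dc := ccontinuous_drift.
have h1 := @continuous_dotv _ _ _ (@ccontinuous_cst _ p) dc s.
have h2 := @continuous_dotv _ _ _ dc dc s.
have e2 : 0 < e / 2 by lra.
move: h1 => /cvgrPdist_lt/(_ _ e2)[d1 /= d10 h1].
move: h2 => /cvgrPdist_lt/(_ _ ltr01)[d2 /= d20 h2].
set D0 := dotv (drift G (x `|s|)) (drift G (x `|s|)) in h2.
have D00 : 0 <= D0 by exact: dotvv_ge0.
(* This bounds the speed near [s]: there the squared norm of the drift is below [D0 + 1], hence its
   norm is at most [D0 + 2], and the disturbance adds at most [opnorm (Hmx G) * c]. *)
pose K := D0 + 2 + opnorm (Hmx G) * c.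
have K0 : 0 <= K by rewrite !addr_ge0// mulr_ge0// opnorm_ge0.
(* The last bound on [t - s] makes the second-order remainder [M * K ^+ 2 * (t - s) ^+ 2] at most
   [e / 2 * (t - s)]. *)
exists (Num.min (Num.min d1 d2) (e / 2 / (M * K ^+ 2 + 1))).
  rewrite !lt_min d10 d20/= divr_gt0// ltr_wpDl// mulr_ge0// sqr_ge0//.
move=> t st; rewrite -ltrBlDl !lt_min => /andP[/andP[td1 td2] td3].
have near_s r : s <= r <= t -> [/\ 0 <= r, `|r| = r, `|s - r| < d1 & `|s - r| < d2].
  move=> /andP[sr rt]; have r0 := le_trans s0 sr; rewrite ger0_norm// distrC.
  by rewrite ger0_norm ?subr_ge0//; split => //; lra.
have incr1 : dotv p (x t - x s) <= (W + e / 2) * (t - s).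
  apply: traj_increment_le => //; apply: ae_sub etac => r eta_r rst.
  have [r0 rr rd1 _] := near_s r rst.
  have := h1 _ rd1; rewrite rr (ger0_norm s0) ltr_norml => /andP[+ _].
  have := HW _ (eta_r r0); rewrite !lure_fieldE !dotvDr -/p.
  rewrite -(ger0_norm s0); lra.
set q := x t - x s in incr1.
have incr2 : enorm q <= K * (t - s).
  have [q0|q0] := eqVneq (enorm q) 0; first by rewrite q0 mulr_ge0// subr_ge0.
  have {}q0 : 0 < enorm q by rewrite lt_def q0 enorm_ge0.
  (* The increment is paired with itself: [enorm q ^+ 2 <= enorm q * K * (t - s)]. *)
  rewrite -(ler_pM2l q0) -expr2 enorm_sqr mulrA.
  apply: traj_increment_le => //; apply: ae_sub etac => r eta_r rst.
  have [r0 rr _ rd2] := near_s r rst.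
  have := h2 _ rd2; rewrite rr ltr_norml => /andP[+ _].
  rewrite -enorm_sqr => hD; have {}hD : enorm (drift G (x r)) <= D0 + 2.
    by have := enorm_ge0 (drift G (x r)); nra.
  rewrite lure_fieldE dotvDr.
  have := le_trans (dotv_le_enorm q (drift G (x r))) (ler_wpM2l (ltW q0) hD).
  have := dotv_le_enorm q (Hmx G *m eta r).
  have : enorm (Hmx G *m eta r) <= opnorm (Hmx G) * c.
    apply: le_trans (enorm_mulmx_le _ _) _.
    by rewrite ler_wpM2l ?opnorm_ge0// eta_r.
  move=> /(ler_wpM2l (ltW q0)); rewrite /K; lra.
have := VM (x s) q; rewrite /q addrC subrK -/q -/p.
have : M * enorm q ^+ 2 <= e / 2 * (t - s).
  have : enorm q ^+ 2 <= (K * (t - s)) ^+ 2.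
    by rewrite ler_pXn2r ?nnegrE ?mulr_ge0 ?enorm_ge0 ?subr_ge0.
  move=> /(ler_wpM2l M0) /le_trans; apply.
  have -> : M * (K * (t - s)) ^+ 2 = M * K ^+ 2 * (t - s) * (t - s) by ring.
  rewrite ler_wpM2r ?subr_ge0//.
  have MK : 0 < M * K ^+ 2 + 1 by rewrite ltr_wpDl// mulr_ge0// sqr_ge0.
  move: td3; rewrite ltr_pdivlMr// => td3.
  have : 0 <= t - s by rewrite subr_ge0.
  nra.
by move: incr1; lra.
Qed.

End Bounded.
End Trajectory.

(** * Continuous induction and the constraint sets *)

Section RealInduction.
Context {R : realType}.
Implicit Types (g : R -> R) (a s t d : R).

(** Were [Q] to fail somewhere, the supremum of the initial segments on which it holds would satisfy
    [Q] by closedness, and the right step would carry [Q] past that supremum. *)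
Lemma real_induction (Q : R -> Prop) a : Q a ->
  (forall t, a < t -> (forall s, a <= s < t -> Q s) -> Q t) ->
  (forall s, a <= s -> Q s -> exists2 d, 0 < d & forall t, s <= t -> t < s + d -> Q
    t) ->
  forall t, a <= t -> Q t.
Proof.
move=> Qa Qclosed Qstep t at_; apply: contrapT => nQt.
pose S := [set s | a <= s /\ forall r, a <= r <= s -> Q r].
have Sa : S a.
  by split => // r /andP[r1 r2]; have -> : r = a by apply/eqP; rewrite eq_le r1 r2.
have St : ubound S t.
  by move=> s [_ sQ]; rewrite leNgt; apply/negP => ts; apply/nQt/sQ; rewrite at_ ltW.
have supS : has_sup S by split; [exists a|exists t].
have au : a <= sup S by apply: ub_le_sup => //; exists t.
have Qlt s : a <= s < sup S -> Q s.
  move=> /andP[a_s su]; have su0 : 0 < sup S - s by rewrite subr_gt0.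
  have [r [_ rQ] sr] := sup_adherent su0 supS.
  by apply: rQ; rewrite a_s /=; lra.
have Qu : Q (sup S).
  by have [<-//|au'] := eqVneq a (sup S); apply: Qclosed => //; rewrite lt_neqAle au'
    au.
have [d d0 dQ] := Qstep _ au Qu.
suff : sup S + d / 2 <= sup S by lra.
apply: ub_le_sup; first by exists t.
split; first by lra.
move=> r /andP[ar rd]; have [rS|Sr] := ltP r (sup S); first by apply: Qlt; rewrite ar.
by apply: dQ => //; lra.
Qed.

Lemma continuous_le0_left g a t : {for t, continuous g} -> a < t ->
  (forall s, a <= s < t -> g s <= 0) -> g t <= 0.
Proof.
move=> gc at_ H; rewrite leNgt; apply/negP => gt0.
have /cvgrPdist_lt/(_ _ gt0)[d /= d0 dH] := gc.
pose s := Num.max a (t - d / 2).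
have st : s < t by rewrite gt_max at_; lra.
have ds : `|t - s| < d.
  rewrite gtr0_norm ?subr_gt0//.
  have : t - d / 2 <= s by rewrite le_max lexx orbT.
  lra.
have := dH _ ds; have : g s <= 0 by apply: H; rewrite st le_max lexx.
rewrite ltr_norml; lra.
Qed.

Lemma continuous_lt_right g s l : {for s, continuous g} -> g s < l ->
  exists2 d, 0 < d & forall t, s <= t -> t < s + d -> g t < l.
Proof.
move=> gc gs; have ls : 0 < l - g s by rewrite subr_gt0.
have /cvgrPdist_lt/(_ _ ls)[d /= d0 dH] := gc.
exists d => // t st td; have : `|s - t| < d by rewrite distrC ger0_norm ?subr_ge0//;
  lra.
by move=> /dH; rewrite ltr_norml; lra.
Qed.

(** A comparison principle for one-sided increments, by continuous induction: below [L] continuity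
    gives a right neighbourhood, and from [L] upwards the assumed decrease does. *)
Lemma right_decrease_bound g L kappa a : 0 <= kappa -> continuous g ->
  (forall s, a <= s -> L <= g s -> exists2 d, 0 < d &
     forall t, s <= t -> t < s + d -> g t - g s <= - kappa * (t - s)) ->
  forall t, a <= t -> g t <= Num.max L (g a - kappa * (t - a)).
Proof.
move=> k0 gc H; apply: real_induction.
- by rewrite le_max subrr mulr0 subr0 lexx orbT.
- move=> t at_ IH; rewrite -subr_le0.
  apply: (@continuous_le0_left (fun s => g s - Num.max L (g a - kappa * (s - a))) a)
    => //.
    apply: cvgB; first exact: gc.
    apply: (@continuous_max _ _ (fun=> L) (fun s => g a - kappa * (s - a))).
      exact: cvg_cst.
    apply: cvgB; first exact: cvg_cst.
    apply: cvgM; first exact: cvg_cst.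
    by apply: cvgB; [exact: cvg_id|exact: cvg_cst].
  by move=> s /IH; rewrite subr_le0.
- move=> s a_s gs; have [Lg|gL] := leP L (g s); last first.
    have [d d0 dH] := continuous_lt_right (gc s) gL; exists d => // t st td.
    by rewrite le_max ltW ?dH.
  have [d d0 dH] := H s a_s Lg; exists d => // t st td.
  have := dH t st td; move: gs; rewrite !le_max => /orP[gs|gs] h.
    by apply/orP; left; nra.
  by apply/orP; right; lra.
Qed.

End RealInduction.

(** * Faces of the constraint sets and levels of the Lyapunov function *)

Section Constraints.
Context {R : realType} {n m : nat} (G : power_system R n m).
Context (thbar : 'I_m -> R) (ombar : 'I_n -> R).
Implicit Types (x z : 'cV[R]_(n + n)) (k : 'I_m) (V : 'cV[R]_(n + n) -> R).
Local Notation dth k := (line_diff G (theq G) k).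

Lemma le_min_over (T : Type) (V : T -> R) (S : set T) (z : T) : S z -> (min_over V S
  <= (V z)%:E)%E.
Proof. by move=> Sz; apply: ereal_inf_lbound; exists z. Qed.

Lemma min_over_subset (T : Type) (V : T -> R) (S S' : set T) : S `<=` S' ->
  (min_over V S' <= min_over V S)%E.
Proof. by move=> SS'; apply: ereal_inf_le_tmp => _ [z Sz <-]; exists z => //; exact:
  SS'. Qed.

Lemma Vhatmax_le_Vmax V : (Vhatmax G thbar ombar V <= Vmax G thbar ombar V)%E.
Proof.
rewrite /Vhatmax /Vmax le_min !ge_min lexx !orbT andbT; apply/orP; left.
apply: le_bigmin2 => k _; rewrite le_min !ge_min; apply/andP; split; apply/orP.
  by left; apply: min_over_subset => z [].
by right; apply: min_over_subset => z [].
Qed.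

Lemma line_diff_scale_freqs c z k :
  line_diff G (freqs (c *: z)) k = c * line_diff G (freqs z) k.
Proof. by rewrite /freqs linearZ /= line_diffZ. Qed.

(** With an outward or tangential flow, [z] would compete in the minimum defining [Vplus] or
    [Vminus], so its value would be at least [Vmax]. *)
Lemma inflow_below_Vmax V z k (sg : R) : sg = 1 \/ sg = -1 -> Pset G thbar z ->
  ((V z)%:E < Vmax G thbar ombar V)%E ->
  sg * line_diff G (angles G z) k = thbar k ->
  sg * line_diff G (freqs z) k < 0.
Proof.
move=> sgE zP zV zk; rewrite ltNge; apply/negP => flow.
have Vk : (Vmax G thbar ombar V <= mine (Vminus G thbar V k) (Vplus G thbar V k))%E.
  rewrite /Vmax ge_min; apply/orP; left.
  exact: (@bigmin_le _ _ _ _ k (fun k => mine (Vminus G thbar V k) (Vplus G thbar V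
    k))).
have := lt_le_trans zV Vk; apply/negP; rewrite -leNgt ge_min; apply/orP.
case: sgE zk flow => ->; rewrite ?mul1r ?mulN1r => zk flow.
  right; apply: le_min_over; split; first by split.
  by move: flow; rewrite subr_ge0.
left; apply: le_min_over; split; first by split => //; rewrite -zk opprK.
by move: flow; rewrite oppr_ge0 subr_le0.
Qed.

Context (P : 'M[R]_(n + n)) (lam : 'I_m -> R).
Hypothesis lam0 : forall k, 0 <= lam k.
Hypothesis posP : posdefmx P.
Hypothesis ombar0 : forall i, 0 < ombar i.
Local Notation V := (Lyap G P lam).

(** Dividing a violating state by its largest ratio of frequency to bound puts it on a face of
    [Sset] with a strictly smaller value of [V], hence below [Wstar], which is absurd. *)
Lemma Xset_Sset z : Xset G thbar ombar V z -> Sset ombar z.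
Proof.
move=> [/= zV _] i0; rewrite leNgt; apply/negP => zi0.
pose r i := `|freqs z i ord0| / ombar i.
pose i := [arg max_(i > i0) r i]%O.
have rmax j : r j <= r i.
  by rewrite /i; case: arg_maxP => //= l _; apply.
have r1 : 1 < r i by apply: lt_le_trans (rmax i0); rewrite ltr_pdivlMr// mul1r.
have ri0 : 0 < r i by apply: lt_trans r1.
have c01 : 0 <= (r i)^-1 < 1 by rewrite invr_ge0 ltW//= invf_lt1.
have z0 : z != 0.
  apply: contraTneq r1 => z0.
  by rewrite /r /freqs z0 linear0 mxE normr0 mul0r -leNgt ler01.
have freqc j : freqs ((r i)^-1 *: z) j ord0 = (r i)^-1 * freqs z j ord0.
  by rewrite /freqs linearZ /= mxE.
have cS : Sset ombar ((r i)^-1 *: z).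
  move=> j; rewrite freqc normrM (gtr0_norm (x := (r i)^-1)) ?invr_gt0//.
  by rewrite mulrC ler_pdivrMr// mulrC -ler_pdivrMr//; exact: rmax.
have ci : `|freqs ((r i)^-1 *: z) i ord0| = ombar i.
  rewrite freqc normrM (gtr0_norm (x := (r i)^-1)) ?invr_gt0// /r invf_div.
  rewrite divfK//; apply: contraTneq ri0 => fi.
  by rewrite /r fi mul0r ltxx.
have := Lyap_scale_lt G lam0 posP c01 z0; apply/negP; rewrite -leNgt -lee_fin.
apply: le_trans zV _; rewrite /Vmax ge_min; apply/orP; right.
apply: (@le_trans _ _ (mine (min_over V (Sminus ombar i)) (min_over V (Splus ombar
  i)))).
  exact: (@bigmin_le _ _ _ _ i (fun i => mine (min_over V (Sminus ombar i)) (min_over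
    V (Splus ombar i)))).
rewrite ge_min; apply/orP.
case: (leP 0 (freqs ((r i)^-1 *: z) i ord0)) => f0.
  by right; apply: le_min_over; split => //; rewrite -ci ger0_norm.
by left; apply: le_min_over; split => //; rewrite -ci ltr0_norm ?opprK.
Qed.

Lemma theq_angle_lt : is_equilibrium G -> forall k, `|dth k| < pi / 2.
Proof.
move=> [_ h] k; apply: le_lt_trans h; rewrite -incidence_trmulE mx_normrE.
exact: (@le_bigmax _ _ _ _ (fun ij => `|((incidence G)^T *m theq G) ij.1 ij.2|) (k,
  ord0)).
Qed.

(** With a single generator at angle [pi / 2] and every other node at 0, all line differences are 0
    or [pi / 2] up to sign. These points turn the inclusion of [P2set] into the lower bound [pi / 2]
    on each [thbar k]. *)
Lemma P2set_boundary_point : simple_lines G -> is_equilibrium G ->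
  forall k, exists2 x, P2set G x & `|line_diff G (angles G x) k| = pi / 2.
Proof.
move=> [noloop _ _] eqG k.
have pi0 : 0 <= pi / 2 :> R by rewrite divr_ge0// pi_ge0.
(* The angle of the infinite bus is fixed, so the endpoint to be moved must be a generator; one
   exists because the two endpoints differ. *)
have [i ik] : exists i : 'I_n, ((line G k).1 == Some i) != ((line G k).2 == Some i).
  case E1 : (line G k).1 (noloop k) => [i|] /=.
    by move=> ne; exists i; rewrite eqxx eq_sym eqb_id eq_sym (negbTE ne)//.
  case E2 : (line G k).2 => [i|]//= _; exists i; by rewrite eqxx.
pose w : 'cV[R]_n := (pi / 2) *: delta_mx i ord0.
have wE u : at_node w u = (pi / 2) * (u == Some i)%:R.
  case: u => [j|]; last by rewrite mulr0.
  by rewrite /w /= !mxE eqxx andbT (inj_eq Some_inj).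
have ldw l : line_diff G w l = (pi / 2) * (((line G l).1 == Some i)%:R - ((line G
  l).2 == Some i)%:R).
  by rewrite /line_diff !wE mulrBr.
exists (col_mx (w - theq G) 0).
  move=> l; rewrite /angles col_mxKu addrC subrK ldw.
  split; last by have := theq_angle_lt eqG l; rewrite ltr_norml => /andP[/ltW -> /ltW
    ->].
  by case: eqP => _; case: eqP => _ /=; rewrite ?subrr ?subr0 ?sub0r ?mulr0 ?mulrN
    ?mulr1; lra.
rewrite /angles col_mxKu addrC subrK ldw normrM (ger0_norm pi0).
move: ik; case: ((line G k).1 == _); case: ((line G k).2 == _) => //= _.
  by rewrite subr0 normr1 mulr1.
by rewrite sub0r normrN1 mulr1.
Qed.

End Constraints.

(** * Invariance *)

Section Invariance.
Context {R : realType} {n m : nat} (G : power_system R n m).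
Context (thbar : 'I_m -> R) (ombar : 'I_n -> R) (dlow : 'I_m -> R).
Context (P : 'M[R]_(n + n)) (lam : 'I_m -> R) (Gam : 'M[R]_m).
Context (eta : R -> 'cV[R]_n) (x : R -> 'cV[R]_(n + n)).
Local Notation V := (Lyap G P lam).
Local Notation dth k := (line_diff G (theq G) k).
Local Notation sigma := (eig_min (- Rmx G dlow P lam Gam)).
Local Notation K := (eig_max P + mu_const G dlow lam * opnorm (Cmx G) ^+ 2).
Local Notation h := (opnorm (P *m Hmx G)).

Hypothesis n0 : (0 < n)%N.
Hypothesis sectorG : sector_bound G thbar dlow.
Hypothesis theq_lt : forall k, `|dth k| < thbar k.
Hypothesis dlow_le : forall k, dlow k <= dhigh G k.
Hypothesis lam0 : forall k, 0 <= lam k.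
Hypothesis posP : posdefmx P.
Hypothesis diagGam : is_diag_mx Gam.
Hypothesis posGam : posdefmx Gam.
Hypothesis negR : negdefmx (Rmx G dlow P lam Gam).
Hypothesis sigma0 : 0 <= sigma.
Hypothesis K0 : 0 < K.
Hypothesis traj : is_trajectory G eta x.

Lemma Lyap_right_decay c L : 0 <= c ->
  {ae @lebesgue_measure R, forall t, 0 <= t -> enorm (eta t) <= c} ->
  0 < L -> 2 * h * c < sigma * Num.sqrt (L / K) ->
  exists2 kappa, 0 < kappa &
    forall s : R, 0 <= s -> Pset G thbar (x s) -> L <= V (x s) ->
    exists2 d : R, 0 < d & forall t : R, s <= t -> t < s + d ->
      V (x t) - V (x s) <= - kappa * (t - s).
Proof.
move=> c0 etac L0 hc; set r := Num.sqrt (L / K) in hc.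
have r0 : 0 < r by rewrite sqrtr_gt0 divr_gt0.
(* Where [V >= L] the norm of the state is at least [r], so the derivative is at most
   [- (2 * kappa)]; half of this is spent on the error term of [Lyap_right_increment]. *)
pose kappa := r * (sigma * r - 2 * h * c) / 2.
have k0 : 0 < kappa by rewrite divr_gt0// mulr_gt0// subr_gt0.
exists kappa => // s s0 sP Ls.
have rx : r <= enorm (x s).
  rewrite -(@ler_pXn2r _ 2)// ?nnegrE ?enorm_ge0 ?(ltW r0)//.
  rewrite sqr_sqrtr; last by rewrite divr_ge0// ltW.
  rewrite ler_pdivrMr// mulrC (le_trans Ls)//.
  exact: (Lyap_le n0 lam0 posP sectorG theq_lt dlow_le sP).
have HW u : enorm u <= c ->
    dotv (lyap_grad G P lam (x s)) (lure_field G (x s) u) <= - (2 * kappa).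
  move=> uc; apply: le_trans (dissipation n0 posP sectorG diagGam posGam negR sigma0
    u sP) _.
  have hu : 2 * h * enorm (x s) * enorm u <= enorm (x s) * (2 * h * c).
    have -> : enorm (x s) * (2 * h * c) = 2 * h * enorm (x s) * c by ring.
    by rewrite ler_wpM2l// !mulr_ge0 ?opnorm_ge0 ?enorm_ge0.
  have : r * (sigma * r - 2 * h * c) <= enorm (x s) * (sigma * enorm (x s) - 2 * h * c).
    apply: ler_pM => //; [exact: ltW|by rewrite subr_ge0 ltW|].
    by rewrite lerB// ler_wpM2l.
  rewrite /kappa; lra.
have [d d0 dH] := Lyap_right_increment traj c0 etac lam0 posP s0 HW k0.
by exists d => // t st td; have := dH t st td; lra.
Qed.

Lemma Lyap_eventually_le c L : 0 <= c ->
  {ae @lebesgue_measure R, forall t, 0 <= t -> enorm (eta t) <= c} ->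
  0 < L -> 2 * h * c < sigma * Num.sqrt (L / K) ->
  (forall t, 0 <= t -> Pset G thbar (x t)) ->
  exists2 T, 0 <= T & forall t, T <= t -> V (x t) <= L.
Proof.
move=> c0 etac L0 hc xP; have [kappa k0 kP] := Lyap_right_decay c0 etac L0 hc.
exists (Num.max 0 ((V (x 0) - L) / kappa)); first by rewrite le_max lexx.
move=> t; rewrite ge_max => /andP[t0]; rewrite ler_pdivrMr// => tL.
have := @right_decrease_bound _ (fun s : R => V (x `|s|)) L kappa 0 (ltW k0)
  (@continuous_Lyap _ _ _ _ _ _ traj P lam).
move=> /(_ _ t t0)/wrap[s s0 |].
  rewrite ger0_norm// => Ls; have [d d0 dH] := kP s s0 (xP s s0) Ls.
  exists d => // r sr rd; rewrite ger0_norm ?(le_trans s0 sr)//; exact: dH.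
rewrite ger0_norm// normr0 subr0 le_max => /orP[//|Vt]; lra.
Qed.

Context (c vhat : R).
Hypothesis c0 : 0 <= c.
Hypothesis etac : {ae @lebesgue_measure R, forall t, 0 <= t -> enorm (eta t) <= c}.
Hypothesis vhat0 : 0 < vhat.
Hypothesis vhat_le : (vhat%:E <= Vmax G thbar ombar V)%E.
Hypothesis c_lt : 2 * h * c < sigma * Num.sqrt (vhat / K).

(** At or above [vhat] the function [V] strictly decreases, even when it starts at [Vmax]; below
    [vhat] continuity keeps it there for a while. *)
Lemma Lyap_lt_Vmax_right s : 0 <= s -> Xset G thbar ombar V (x s) ->
  exists2 d : R, 0 < d & forall t : R, s < t -> t < s + d ->
    ((V (x t))%:E < Vmax G thbar ombar V)%E.
Proof.
move=> s0 [/= sV sP]; have [Ls|sL] := leP vhat (V (x s)).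
  have [kappa k0 /(_ s s0 sP Ls)[d d0 dH]] := Lyap_right_decay c0 etac vhat0 c_lt.
  exists d => // t st td; apply: lt_le_trans sV; rewrite lte_fin.
  by have := dH t (ltW st) td; nra.
have Vc := @continuous_Lyap _ _ _ _ _ _ traj P lam s.
have [|d d0 dH] := continuous_lt_right Vc (l := vhat).
  by rewrite ger0_norm.
exists d => // t st td; apply: lt_le_trans vhat_le; rewrite lte_fin.
by have := dH t (ltW st) td; rewrite ger0_norm//; lra.
Qed.

Let z k (t : R) := (Cmx G *m x `|t|) k ord0.

Let z_continuous k : continuous (z k).
Proof. by move=> t; exact: (@ccontinuous_mulmx _ _ _ (Cmx G) _ (traj_continuous traj)
  k t). Qed.

Let sgn (b : bool) : R := (-1) ^+ b.
(* The gauge of the polytope of admissible angles: [gauge y (k, b) <= 1] is the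
   constraint [(-1)^b * theta_k <= thbar k]. *)
Let den (kb : 'I_m * bool) : R := thbar kb.1 - sgn kb.2 * dth kb.1.
Let den_gt0 kb : 0 < den kb.
Proof.
have := theq_lt kb.1; rewrite /den /sgn subr_gt0 ltr_norml.
by case: kb.2; rewrite ?expr1 ?expr0; lra.
Qed.

Let gauge (y : 'cV[R]_(n + n)) kb := sgn kb.2 * (Cmx G *m y) kb.1 ord0 / den kb.

Let Pset_gauge y : Pset G thbar y <-> forall kb, gauge y kb <= 1.
Proof.
split=> [yP [k b]|yP k].
  rewrite /gauge ler_pdivrMr ?den_gt0// mul1r /den /=.
  have := yP k; rewrite line_diff_angles ler_norml /sgn.
  by case: b; rewrite ?expr1 ?expr0; lra.
have := yP (k, true); have := yP (k, false).
rewrite /gauge !ler_pdivrMr ?den_gt0// !mul1r /den /sgn /= expr1 expr0.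
by rewrite line_diff_angles ler_norml; lra.
Qed.

Let gauge_continuous kb : continuous (fun t : R => gauge (x `|t|) kb).
Proof.
move=> t; apply: cvgM; last exact: cvg_cst.
by apply: cvgM; [exact: cvg_cst|exact: z_continuous].
Qed.

Let line_diff_freqs_continuous k :
  continuous (fun t : R => line_diff G (freqs (x `|t|)) k).
Proof.
move=> t; rewrite (_ : (fun _ => _) = fun s : R => ((incidence G)^T *m freqs (x
  `|s|)) k ord0).
  apply: (@ccontinuous_mulmx _ _ _ (incidence G)^T (fun s : R => freqs (x `|s|))).
  move=> i {}t; rewrite (_ : (fun _ => _) = fun s : R => x `|s| (rshift n i) ord0).
    exact: (traj_continuous traj).
  by apply/funext => s; rewrite /freqs mxE.
by apply/funext => s; rewrite incidence_trmulE.
Qed.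

Lemma Pset_right (s d : R) : 0 <= s -> Pset G thbar (x s) ->
  (forall t : R, s < t -> t < s + d -> ((V (x t))%:E < Vmax G thbar ombar V)%E) ->
  forall t : R, s <= t -> t < s + d -> Pset G thbar (x t).
Proof.
move=> s0 sP dV t1 st1 t1d; apply: contrapT => nP.
have [kb0 kb0P] : exists kb, 1 < gauge (x t1) kb.
  apply: contrapT => /forallNP H; apply: nP; apply/Pset_gauge => kb.
  by rewrite leNgt; apply/negP/H.
have argmax kb : {t : R | s <= t <= t1 & forall r, s <= r <= t1 ->
    gauge (x `|r|) kb <= gauge (x `|t|) kb}.
  apply: cid2; have [|t tin tmax] := @EVT_max R (fun t : R => gauge (x `|t|) kb) s t1
    st1.
    exact/continuous_subspaceT/gauge_continuous.
  by exists t => //= r rin; apply: tmax.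
(* Maximising first in time for each constraint and then over the finitely many constraints gives a
   joint maximum, at time [t] and constraint [kb]. *)
pose g kb := gauge (x `|s2val (argmax kb)|) kb.
pose kb := [arg max_(j > kb0) g j]%O.
have gmax j : g j <= g kb by rewrite /kb; case: arg_maxP => //= l _; apply.
move: gmax; rewrite /g; case: (argmax kb) => /= t st gt gmax.
have {}gmax j r : s <= r <= t1 -> gauge (x `|r|) j <= gauge (x `|t|) kb.
  by move=> sr; apply: le_trans (gmax j); case: (argmax j) => /= t' _; apply.
move: (st) => /andP[s_t t_t1].
have t0 : 0 <= t by apply: le_trans s_t.
set rho := gauge (x `|t|) kb in gmax gt.
have rho1 : 1 < rho.
  apply: lt_le_trans kb0P _; rewrite -(ger0_norm (le_trans s0 st1)).
  by apply: gmax; rewrite lexx andbT.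
have rho0 : 0 < rho by apply: lt_trans rho1.
have {s_t}s_t : s < t.
  rewrite lt_neqAle s_t andbT; apply/eqP => E; have := (Pset_gauge _).1 sP kb.
  by rewrite leNgt -(ger0_norm s0) E -/rho rho1.
(* Since [rho] is the largest gauge, [y] satisfies every constraint, with equality at [kb]. *)
pose y := rho^-1 *: x t.
have gy j : gauge y j = rho^-1 * gauge (x t) j.
  by rewrite /gauge /y -scalemxAr mxE; ring.
have rhoE : rho = gauge (x t) kb by rewrite /rho ger0_norm.
have yP : Pset G thbar y.
  apply/Pset_gauge => j; rewrite gy mulrC ler_pdivrMr// mul1r.
  by rewrite -{1}(ger0_norm t0); exact: gmax.
have xt0 : x t != 0.
  apply: contraTneq rho0 => xt0; rewrite rhoE xt0 /gauge mulmx0 mxE.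
  by rewrite mulr0 mul0r ltxx.
have yV : ((V y)%:E < Vmax G thbar ombar V)%E.
  apply: (@lt_trans _ _ (V (x t))%:E); last by apply: dV => //; lra.
  rewrite lte_fin; apply: Lyap_scale_lt => //.
  by rewrite invr_ge0 ltW//= invf_lt1.
have sgE : sgn kb.2 = 1 \/ sgn kb.2 = -1.
  by rewrite /sgn; case: kb.2; rewrite ?expr0 ?expr1; [right|left].
have sg2 : sgn kb.2 * sgn kb.2 = 1 by case: sgE => ->; ring.
have ybd : sgn kb.2 * line_diff G (angles G y) kb.1 = thbar kb.1.
  have : gauge y kb = 1 by rewrite gy -rhoE mulVf ?gt_eqF.
  rewrite /gauge => /(congr1 (fun w => w * den kb)).
  rewrite divfK ?gt_eqF// mul1r line_diff_angles /den => E.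
  by rewrite mulrDr E; ring.
have := inflow_below_Vmax sgE yP yV ybd.
rewrite /y line_diff_scale_freqs mulrCA pmulr_rlt0 ?invr_gt0// => flow.
set a := sgn kb.2 * _ in flow.
have fc : {for t, continuous (fun r : R => sgn kb.2 * line_diff G (freqs (x `|r|))
  kb.1)}.
  by apply: cvgM; [exact: cvg_cst|exact: line_diff_freqs_continuous].
have a2 : 0 < - a / 2 by lra.
have /cvgrPdist_lt/(_ _ a2)[e /= e0 eH] := fc.
(* On the interval from [t'] to [t] the signed frequency difference stays below [a / 2 < 0], so the
   gauge of [kb] is larger at [t'] than at [t]. *)
pose t' := Num.max s (t - e / 2).
have t't : t' < t by rewrite gt_max s_t; lra.
have st' : s <= t' by rewrite le_max lexx.
have et' : t - e / 2 <= t' by rewrite le_max lexx orbT.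
have t'0 : 0 <= t' by lra.
have := line_diff_increment_le traj (sg := sgn kb.2) (k := kb.1) (a := a / 2) t'0
  (ltW t't).
move=> /(_ _)/wrap[r /andP[r1 r2]|].
  have : `|t - r| < e by rewrite ger0_norm; lra.
  move=> /eH; rewrite (ger0_norm t0) (ger0_norm (le_trans t'0 r1)).
  by rewrite -/a ltr_norml; lra.
have : gauge (x `|t'|) kb <= rho by apply: gmax; lra.
rewrite rhoE /gauge ler_pM2r ?invr_gt0// (ger0_norm t'0).
have : a / 2 * (t - t') < 0 by rewrite pmulr_llt0 ?subr_gt0//; lra.
lra.
Qed.

Lemma Xset_invariant : Xset G thbar ombar V (x 0) ->
  forall t, 0 <= t -> Xset G thbar ombar V (x t).
Proof.
move=> X0; apply: real_induction => //.
- move=> t t0 IH; split.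
    rewrite /=; case E : (Vmax G thbar ombar V) => [v||]; last 2 first.
    + by rewrite leey.
    + by have [] := IH 0; rewrite ?lexx ?t0//= E leeNy_eq.
    rewrite lee_fin -(ger0_norm (ltW t0)) -subr_le0.
    apply: (@continuous_le0_left _ (fun s : R => V (x `|s|) - v) 0) => //.
      by apply: cvgB; [exact: (@continuous_Lyap _ _ _ _ _ _ traj)|exact: cvg_cst].
    move=> s /[dup] /andP[s0 _] /IH[/=]; rewrite E lee_fin ger0_norm// => sv _.
    by rewrite subr_le0.
  apply/Pset_gauge => kb; rewrite -(ger0_norm (ltW t0)) -subr_le0.
  apply: (@continuous_le0_left _ (fun s : R => gauge (x `|s|) kb - 1) 0) => //.
    by apply: cvgB; [exact: gauge_continuous|exact: cvg_cst].
  move=> s /[dup] /andP[s0 _] /IH[_ /Pset_gauge/(_ kb)]; rewrite ger0_norm// subr_le0.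
  by [].
- move=> s s0 sX; have [d d0 dV] := Lyap_lt_Vmax_right s0 sX.
  exists d => // t st td; split; last exact: (Pset_right s0 sX.2 dV).
  (* The strict bound holds only after [s]; at [s] itself [V] may equal [Vmax]. *)
  have [<-|ne] := eqVneq s t; first by case: sX.
  by apply/ltW/dV => //; rewrite lt_neqAle ne.
Qed.

End Invariance.

(** * Convergence *)

Section Convergence.
Context {R : realType}.

(** A nonnegative [c] below [etabar] makes it positive, which excludes every degenerate factor: the
    inverse of 0, the root of a nonpositive number and [fine] of an infinite value are all 0.
    Positivity of [sigma] then follows from the sign of the product. *)
Lemma etabar_gt0P (n m : nat) (G : power_system R n m)
    thbar ombar dlow (P : 'M[R]_(n + n)) lam (Gam : 'M[R]_m) (c : R) :
  let K := eig_max P + mu_const G dlow lam * opnorm (Cmx G) ^+ 2 in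
  let sigma := eig_min (- Rmx G dlow P lam Gam) in
  0 <= c -> c < etabar G thbar ombar dlow P lam Gam ->
  exists2 v : R, [/\ 0 < v, 0 < K & 0 < sigma] &
    Vhatmax G thbar ombar (Lyap G P lam) = v%:E /\
    2 * opnorm (P *m Hmx G) * c < sigma * Num.sqrt (v / K).
Proof.
move=> K sigma c0 c_lt; have e0 := le_lt_trans c0 c_lt.
move: e0 c_lt; rewrite /etabar -/K -/sigma.
set h := opnorm (P *m _); set vE := Vhatmax _ _ _ _; set v := fine vE => e0 c_lt.
have h0 : 0 < h.
  rewrite lt_def opnorm_ge0 andbT; apply: contraTneq e0 => ->.
  by rewrite mulr0 mul0r invr0 mulr0 mul0r ltxx.
have K0 : 0 < K.
  rewrite ltNge; apply: contraTN e0 => /ler0_sqrtr ->.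
  by rewrite mulr0 invr0 mulr0 mul0r ltxx.
have v0 : 0 < v.
  rewrite ltNge; apply: contraTN e0 => /ler0_sqrtr ->.
  by rewrite mulr0 ltxx.
have sv0 : 0 < Num.sqrt v by rewrite sqrtr_gt0.
have sK0 : 0 < Num.sqrt K by rewrite sqrtr_gt0.
have s0 : 0 < sigma.
  by move: e0; rewrite pmulr_lgt0// pmulr_lgt0// invr_gt0 !mulr_gt0.
exists v; first by [].
split.
  rewrite /v fineK// fin_numE; apply/andP.
  by split; apply: contraTneq v0; rewrite /v => ->; rewrite ltxx.
rewrite sqrtrM ?(ltW v0)// sqrtrV ?(ltW K0)//.
have hK0 : 0 < 2 * h * Num.sqrt K by rewrite !mulr_gt0.
move: c_lt; rewrite mulrAC ltr_pdivlMr// => c_lt.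
by rewrite mulrA ltr_pdivlMr//; lra.
Qed.

Lemma enorm_lt_mx_norm n (v : 'cV[R]_n) e : 0 < e -> enorm v < e -> `|v| < e.
Proof.
move=> e0 ve; rewrite [`|v|]mx_normrE; apply/bigmax_ltP; split => // -[i j] _ /=.
by rewrite ord1; apply: le_lt_trans ve; exact: coord_le_enorm.
Qed.

End Convergence.

Theorem mainTheorem3 (R : realType) (n m : nat) (G : power_system R n m)
    (thbar : 'I_m -> R) (ombar : 'I_n -> R) (dlow : 'I_m -> R)
    (P : 'M[R]_(n + n)) (lam : 'I_m -> R) (Gam : 'M[R]_m)
    (eta : R -> 'cV[R]_n) (x : R -> 'cV[R]_(n + n)) :
  (0 < n)%N ->
  simple_lines G ->
  connected_graph G ->
  (forall i, 0 < inertia G i) ->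
  (forall i, 0 < damping G i) ->
  (forall k, 0 < coupling G k) ->
  is_equilibrium G ->
  P2set G `<=` Pset G thbar ->
  Pset G thbar `<=` P1set G ->
  (forall i, 0 < ombar i) ->
  sector_bound G thbar dlow ->
  lower_sector_value G thbar dlow ->
  posdefmx P ->
  (forall k, 0 <= lam k) ->
  is_diag_mx Gam ->
  posdefmx Gam ->
  let V := Lyap G P lam in
  let X := Xset G thbar ombar V in
  negdefmx (Rmx G dlow P lam Gam) ->
  (forall i : 'I_n, measurable_fun (`[0, +oo[ : set R) (fun t : R => eta t i ord0 : R)) ->
  (Linfty_norm eta < (etabar G thbar ombar dlow P lam Gam)%:E)%E ->
  is_trajectory G eta x ->
  X (x 0) ->
  [/\ forall t, 0 <= t -> X (x t),
      forall t, 0 <= t -> Pset G thbar (x t) /\ Sset ombar (x t),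
      converges_to_set x [set y | ((V y)%:E < Vhatmax G thbar ombar V)%E] &
      (forall t, 0 <= t -> eta t = 0) -> x t @[t --> +oo] --> (0 : 'cV[R]_(n + n))].
Proof.
move=> n0 simpleG _ _ _ _ eqG P2P _ ombar0 sectorG _ posP lam0 diagGam posGam.
move=> V X negR _ eta_lt traj X0.
have thP k : pi / 2 <= thbar k.
  by have [y /P2P/(_ k) yk <-] := P2set_boundary_point simpleG eqG k.
have theq_lt k : `|line_diff G (theq G) k| < thbar k.
  exact: lt_le_trans (theq_angle_lt eqG k) (thP k).
(* The sector interval is nonempty: a state of the polytope with angle difference [pi / 2] in
   absolute value on line [k] has a nonzero output there, since the equilibrium difference is
   smaller. *)
have dlow_le k : dlow k <= dhigh G k.
  have [y yP yk] := P2set_boundary_point simpleG eqG k.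
  have := sectorG y (P2P _ yP) k; set z := (Cmx G *m y) k ord0 => /= zP.
  have /zP/andP[] : z != 0; last by exact: le_trans.
  apply: contra_eq_neq yk => z0; rewrite line_diff_angles -/z z0 addr0.
  by rewrite lt_eqF// theq_angle_lt.
have [c /andP[c0 c_lt] etac] := Linfty_norm_lt eta_lt.
have [v [v0 K0 s0] [vE hc]] := etabar_gt0P c0 c_lt.
have XP : forall t, 0 <= t -> X (x t).
  apply: (Xset_invariant n0 sectorG theq_lt dlow_le lam0 posP diagGam posGam negR
    (ltW s0) K0 traj c0 etac v0 _ hc X0).
  by rewrite -vE; exact: Vhatmax_le_Vmax.
have xP t : 0 <= t -> Pset G thbar (x t) by move=> /XP[].
have evle := Lyap_eventually_le n0 sectorG theq_lt dlow_le lam0 posP diagGam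
  posGam negR (ltW s0) K0 traj.
have [p p0 pP] := posdefmx_coercive posP.
have V_ge y : p * enorm y ^+ 2 <= V y.
  by apply: le_trans (pP y) _; exact: Lyap_ge.
split => //.
- by move=> t t0; split; [exact: xP|apply: (Xset_Sset lam0 posP ombar0); exact: XP].
- move=> e e0; have [T T0 TV] := evle c v c0 etac v0 hc xP.
  pose b := v / p + 1; have b0 : 0 < b by rewrite ltr_wpDl// divr_ge0 ?ltW.
  near=> t; have /TV Vt : T <= t by near: t; exact: (nbhs_pinfty_ge (num_real T)).
  have xb : enorm (x t) <= b.
    have : enorm (x t) ^+ 2 <= v / p.
      by rewrite ler_pdivlMr// mulrC (le_trans (V_ge _)).
    by have := enorm_ge0 (x t); rewrite /b; nra.
  (* Eventually [V] is only at most [v], while the target is a strict sublevel set. Shrinking by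
     [1 - d] makes the inequality strict and moves the state by at most [d * b < e]. *)
  pose d := e / (e + b); have eb : 0 < e + b by rewrite addr_gt0.
  have d0 : 0 < d by rewrite divr_gt0.
  have d1 : d < 1 by rewrite ltr_pdivrMr// mul1r ltrDl.
  exists ((1 - d) *: x t).
    rewrite /= vE lte_fin; have [->|x0] := eqVneq (x t) 0.
      by rewrite scaler0 /V Lyap0.
    by apply: lt_le_trans Vt; apply: Lyap_scale_lt => //; lra.
  rewrite scalerBl scale1r opprB addrC subrK enormZ gtr0_norm//.
  apply: (@le_lt_trans _ _ (d * b)); first by rewrite ler_pM2l.
  by rewrite /d mulrAC ltr_pdivrMr// ltr_pM2l// ltrDr.
- move=> eta0.
  have eta0ae : {ae @lebesgue_measure R, forall t, 0 <= t -> enorm (eta t) <= 0}.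
    by apply: aeW => t t0; rewrite eta0// enorm0.
  apply/cvgr0Pnorm_lt => e e0.
  (* Without disturbance every positive level is eventually reached; coercivity turns this one into
     [enorm (x t) <= e / 2]. *)
  have L0 : 0 < p * (e / 2) ^+ 2 by rewrite mulr_gt0// exprn_gt0// divr_gt0.
  have [|T T0 TV] := evle 0 _ (lexx 0) eta0ae L0 _ xP.
    by rewrite mulr0 mulr_gt0// sqrtr_gt0 divr_gt0.
  near=> t; have /TV Vt : T <= t by near: t; exact: (nbhs_pinfty_ge (num_real T)).
  apply: enorm_lt_mx_norm => //.
  have := le_trans (V_ge (x t)) Vt; rewrite ler_pM2l//.
  by have := enorm_ge0 (x t); nra.
Unshelve. all: by end_near. Qed.
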